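(* Let $U$ be a star-shaped open region of an $n$-dimensional Riemannian manifold, let $0<k<n$, and let $\alpha\in\Lambda^{k-1}(U)$, $\beta\in\Lambda^{k+1}(U)$ be a solution of the system $$\delta\alpha=0,\qquad d\alpha-\delta\beta=0,\qquad d\beta=0$$ (equivalently, $\psi=\alpha+\beta$ solves the vacuum Dirac–Kähler equation $(d-\delta)\psi=0$). Then one of the following holds: (gauge case) $\alpha\in\mathcal{E}^{k-1}\cap\mathcal{C}^{k-1}$ and $\beta\in\mathcal{E}^{k+1}\cap\mathcal{C}^{k+1}$; or (non-gauge case) $\alpha\notin\mathcal{E}^{k-1}$, $\beta\notin\mathcal{C}^{k+1}$, and $d\alpha\in\mathcal{E}^{k}\cap\mathcal{C}^{k}$, $\delta\beta\in\mathcal{E}^{k}\cap\mathcal{C}^{k}$.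
   Context: A star-shaped open region $U$ of a smooth manifold $M$ with $\dim M=n$ is an open subset diffeomorphic to an open ball in $\mathbb{R}^n$. $\Lambda^k(U)$ denotes smooth $k$-forms on $U$. $U$ is oriented and carries a Riemannian metric (arbitrary, not necessarily flat), with standard Hodge star $\star$. $\eta\omega=(-1)^p\omega$ for $\omega\in\Lambda^p(U)$, and the codifferential is $\delta=\star^{-1}d\star\eta$ (zero on $0$-forms). $\mathcal{E}^j=\{\omega\in\Lambda^j(U):d\omega=0\}$ and $\mathcal{C}^j=\{\omega\in\Lambda^j(U):\delta\omega=0\}$. *)

(* Defs.v *)
From HB Require Import structures.
From mathcomp Require Import all_boot all_order all_algebra.
From mathcomp Require Import all_classical all_reals all_analysis.
Import Order.TTheory GRing.Theory Num.Theory.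
Import numFieldNormedType.Exports.

Set Implicit Arguments.
Unset Strict Implicit.
Unset Printing Implicit Defensive.

Local Open Scope classical_set_scope.
Local Open Scope ring_scope.

(** * Smooth maps and smooth manifolds *)

(* [f] is C^oo on the (open) set [A]: every iterated directional derivative of
   [f], including [f] itself, is Frechet differentiable at each point of [A]. *)
Definition smooth_on (R : realType) (V W : normedModType R)
    (A : set V) (f : V -> W) : Prop :=
  forall (vs : seq V) (x : V), A x ->
    differentiable (foldr (fun v (h : V -> W) => 'D_v h) f vs) x.

(* The atlas need not be maximal.  [coordV i] inverts [coord i] on the range of
   the chart; [coord i] off [dom i] and [coordV i] off the range are junk. *)
Record smooth_manifold (R : realType) (n : nat) := SmoothManifold {
  carrier :> topologicalType;
  chart : Type;
  dom : chart -> set carrier;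
  coord : chart -> carrier -> 'rV[R]_n;
  coordV : chart -> 'rV[R]_n -> carrier;
  manifold_hausdorff : hausdorff_space carrier;
  manifold_second_countable : @second_countable carrier;
  dom_cover : forall p, exists i, dom i p;
  dom_open : forall i, open (dom i);
  range_open : forall i, open (coord i @` dom i);
  coordK : forall i p, dom i p -> coordV i (coord i p) = p;
  chart_continuous : forall i, {in dom i, continuous (coord i)};
  chartV_continuous : forall i, {in coord i @` dom i, continuous (coordV i)};
  transition_smooth : forall i j,
    smooth_on (coord i @` (dom i `&` dom j)) (coord j \o coordV i) }.

Section Manifold.
Context {R : realType} {n : nat} {M : smooth_manifold R n}.
Implicit Types (U : set M) (i j : chart M) (p : M).

(* A tangent vector at [p] with coordinates [v] in chart [i] has coordinates
   [v *m transition_jac i j p] in chart [j]. *)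
Definition transition_jac i j p : 'M[R]_n :=
  jacobian (coord j \o coordV i) (coord i p).

(* The Euclidean ball: the norm of ['rV[R]_n] is the sup norm, so [ball] would
   be a cube. *)
Definition euclidean_ball (c : 'rV[R]_n) (r : R) : set 'rV[R]_n :=
  [set x | \sum_(a < n) (x ord0 a - c ord0 a) ^+ 2 < r ^+ 2].

Definition diffeomorphism U (B : set 'rV[R]_n)
    (f : M -> 'rV[R]_n) (h : 'rV[R]_n -> M) : Prop :=
  [/\ (forall p, U p -> B (f p) /\ h (f p) = p),
      (forall x, B x -> U (h x) /\ f (h x) = x),
      (forall i, smooth_on (coord i @` (U `&` dom i)) (f \o coordV i)),
      {in B, continuous h}
    & (forall i, smooth_on (B `&` h @^-1` dom i) (coord i \o h))].

Definition star_shaped U : Prop :=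
  open U /\ exists (c : 'rV[R]_n) (r : R) (f : M -> 'rV[R]_n)
    (h : 'rV[R]_n -> M), 0 < r /\ diffeomorphism U (euclidean_ball c r) f h.

(** * Metrics and orientations *)

(* [g i p] is the Gram matrix, at [p], of the coordinate frame of chart [i]. *)
Definition riemannian_metric U (g : chart M -> M -> 'M[R]_n) : Prop :=
  [/\ (forall i p, (U `&` dom i) p -> (g i p)^T = g i p),
      (forall i p, (U `&` dom i) p ->
         forall v : 'rV[R]_n, v != 0 -> 0 < (v *m g i p *m v^T) ord0 ord0),
      (forall i (a b : 'I_n), smooth_on (coord i @` (U `&` dom i))
         (fun x => g i (coordV i x) a b : R^o))
    & (forall i j p, (U `&` dom i `&` dom j) p ->
         g i p = transition_jac i j p *m g j p *m (transition_jac i j p)^T)].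

(* [o i p] is [1] or [-1] according to whether the coordinate frame of chart [i]
   at [p] is positively oriented or not. *)
Definition orientation U (o : chart M -> M -> R) : Prop :=
  [/\ (forall i p, (U `&` dom i) p -> o i p = 1 \/ o i p = -1),
      (forall i, {in U `&` dom i, continuous (o i)})
    & (forall i j p, (U `&` dom i `&` dom j) p ->
         o i p = Num.sg (\det (transition_jac i j p)) * o j p)].

(** * Pointwise exterior algebra *)

(* The exterior algebra of the dual of R^n consists of the alternating functions
   of a list of vectors; the restriction of such a function to lists of length
   [k] is its component of degree [k]. *)
Definition multicovector := seq 'rV[R]_n -> R.
Implicit Types (w : multicovector) (vs : seq 'rV[R]_n).

Definition is_alternating w : Prop :=
  (forall (s t : seq 'rV[R]_n) (a : R) (u v : 'rV[R]_n),
     w (s ++ (a *: u + v) :: t) = a * w (s ++ u :: t) + w (s ++ v :: t)) /\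
  (forall (s t r : seq 'rV[R]_n) (u : 'rV[R]_n),
     w (s ++ u :: t ++ u :: r) = 0).

Definition homogeneous (k : nat) w : Prop := forall vs, size vs <> k -> w vs = 0.

Definition frame_vec (a : 'I_n) : 'rV[R]_n := delta_mx ord0 a.

Definition volume_form (G : 'M[R]_n) (s : R) : multicovector := fun vs =>
  if size vs == n
  then s * Num.sqrt (\det G) * \det (\matrix_(a < n) nth 0 vs a) else 0.

(* On degree [k]: (star w)_{c_1..c_{n-k}} =
     (1/k!) w_{a_1..a_k} G^{a_1 b_1} .. G^{a_k b_k} vol_{b_1..b_k c_1..c_{n-k}},
   i.e. w' /\ star w = <w', w> vol.  If [size vs > n] the value is 0, because
   [volume_form] then vanishes. *)
Definition hodge_star (G : 'M[R]_n) (s : R) w : multicovector := fun vs =>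
  let k := (n - size vs)%N in
  (k`!%:R)^-1 *
  \sum_(a : k.-tuple 'I_n) \sum_(b : k.-tuple 'I_n)
    (\prod_(l < k) invmx G (tnth a l) (tnth b l)) *
    w (map frame_vec a) * volume_form G s (map frame_vec b ++ vs).

(* For [G] positive definite and [s = 1] or [s = -1], [hodge_star G s] is a
   bijection of the alternating multicovectors, and this is its inverse. *)
Definition hodge_star_inv (G : 'M[R]_n) (s : R) w : multicovector :=
  get [set w' : multicovector | is_alternating w' /\ hodge_star G s w' = w].

(** * Differential forms *)

(* [omega i p vs] is the value of [omega] at [p] on the tangent vectors whose
   coordinates in chart [i] are [vs].  A form on [U] is only meaningful at
   points of [U `&` dom i], whence [eq_on]. *)
Definition field := chart M -> M -> seq 'rV[R]_n -> R.
Implicit Types omega theta : field.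

Definition eq_on U omega theta : Prop :=
  forall i p, (U `&` dom i) p -> forall vs, omega i p vs = theta i p vs.

Definition field0 : field := fun _ _ _ => 0.

Definition sub_field omega theta : field :=
  fun i p vs => omega i p vs - theta i p vs.

Definition Lambda U (k : nat) : set field :=
  [set omega | [/\
    (forall i p, (U `&` dom i) p ->
       is_alternating (omega i p) /\ homogeneous k (omega i p)),
    (forall i vs, smooth_on (coord i @` (U `&` dom i))
       (fun x => omega i (coordV i x) vs : R^o))
  & (forall i j p, (U `&` dom i `&` dom j) p -> forall vs,
       omega i p vs = omega j p [seq v *m transition_jac i j p | v <- vs])]].

(* (d omega)(v_0, .., v_k) =
     sum_l (-1)^l D_{v_l} [omega(v_0, .., v_{l-1}, v_{l+1}, .., v_k)],
   with [v_0, .., v_k] constant in the chart. *)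
Definition ext_d omega : field := fun i p vs =>
  \sum_(l < size vs) (-1) ^+ l *
    'D_(nth 0 vs l)
      (fun x => omega i (coordV i x) (take l vs ++ drop l.+1 vs) : R^o)
      (coord i p).

Definition eta omega : field := fun i p vs => (-1) ^+ size vs * omega i p vs.

Definition star (g : chart M -> M -> 'M[R]_n) (o : chart M -> M -> R) omega
    : field :=
  fun i p => hodge_star (g i p) (o i p) (omega i p).

Definition star_inv (g : chart M -> M -> 'M[R]_n) (o : chart M -> M -> R) omega
    : field :=
  fun i p => hodge_star_inv (g i p) (o i p) (omega i p).

(* No case split for 0-forms: there [ext_d (star _ _ (eta omega))] has degree
   [n + 1], hence vanishes, and so does its image under [star_inv]. *)
Definition codiff (g : chart M -> M -> 'M[R]_n) (o : chart M -> M -> R) omega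
    : field :=
  star_inv g o (ext_d (star g o (eta omega))).

Definition closed_forms U (k : nat) : set field :=
  [set omega | Lambda U k omega /\ eq_on U (ext_d omega) field0].

Definition coclosed_forms U (g : chart M -> M -> 'M[R]_n)
    (o : chart M -> M -> R) (k : nat) : set field :=
  [set omega | Lambda U k omega /\ eq_on U (codiff g o omega) field0].

End Manifold.

Arguments field {R n} M.
Arguments field0 {R n M}.

(* Main.v *)
From HB Require Import structures.
From mathcomp Require Import all_boot all_order all_algebra.
From mathcomp Require Import all_classical all_reals all_analysis.
From mathcomp Require Import ring.
From mathcomp Require polyrcf.
Require Import Defs.
Import Order.TTheory GRing.Theory Num.Theory.
Import numFieldNormedType.Exports.
Set Implicit Arguments.
Unset Strict Implicit.
Unset Printing Implicit Defensive.
Local Open Scope classical_set_scope.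
Local Open Scope ring_scope.

(** If [d alpha = 0] then [delta beta = 0] and we are in the gauge case.  If not,
    [alpha] is not closed and [beta] is not coclosed, while the common value of
    [d alpha] and [delta beta] is killed by [d] because [d d = 0] and by [delta]
    because [delta delta = 0].  The latter reduces to [d d = 0] since
    [star] is, up to sign, an involution of the alternating multicovectors, so
    that [star^-1] really is its inverse.  That [d alpha] is again a form needs
    the independence of [d] from the chart, i.e. the symmetry of the second
    derivatives of the transition maps. *)

(** * Calculus of smooth functions *)

(** The metric part is shaped by the choice operator in [hodge_star_inv]: it returns some
    alternating preimage, so [delta delta = 0] needs both that preimages exist and that zero has no
    other preimage than zero. Both follow once the square of the star is a sign in each degree, and
    this uses [det G > 0], since the factor [sqrt(det G)^2 * det(G^-1)] has to be [1]. A
    multicovector carries all degrees at once. Signs depending on the degree are therefore functions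
    of the length of the list, and the scaling lemmas for alternation, star and [d] allow an
    arbitrary function of the length. [delta beta] is recognised as a form through its equality with
    [d alpha] on [U], not through regularity of [star^-1]. *)

Section SmoothCalculus.
Context {R : realType} {V : normedModType R}.
Implicit Types (A : set V) (v w : V) (x : V).

(** The first-order expansion of [f] at [x] with its little-o remainder is a statement near [x],
    hence also one about [g]; [diff_unique] then identifies the differential of [g]. *)
Lemma near_eq_differentiable (W : normedModType R) (f g : V -> W) x :
  (\near x, f x = g x) -> differentiable f x -> differentiable g x.
Proof.
move=> fg df.
have fgx : f x = g x := nbhs_singleton fg.
have gE : g \o shift x = cst (g x) + 'd f x +o_ 0 id.
  apply/eqaddoP => e e0.
  have /eqaddoP/(_ _ e0) fo := diff_locally df.
  have fgx0 : \forall h \near (0 : V), f (h + x) = g (h + x).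
    by move: fg; rewrite (near_shift 0)/= subr0.
  apply: filterS2 fgx0 fo => h fgh.
  by rewrite /= -fgx [X in `|X| <= _](_ : _ = g (h + x) - (f x + 'd f x h)) //
    -fgh.
have dc : continuous ('d f x) by exact: diff_continuous.
have dg : 'd g x = 'd f x :> (V -> W) by exact: diff_unique.
by apply/diff_locallyP; rewrite dg.
Qed.

Lemma open_near A x (P : V -> Prop) :
  open A -> A x -> (forall y, A y -> P y) -> \forall y \near x, P y.
Proof.
by move=> oA Ax AP; apply: filterS AP _; exact: open_nbhs_nbhs.
Qed.

Lemma derive_ext A (W : normedModType R) (f g : V -> W) v x :
  open A -> A x -> (forall y, A y -> f y = g y) -> 'D_v f x = 'D_v g x.
Proof. by move=> oA Ax fg; apply: near_eq_derive; exact: open_near fg. Qed.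

(* Stratifying smoothness by the order makes it provable by induction that the
   class is closed under products, inverses and square roots. *)
Fixpoint smooth_upto (W : normedModType R) (m : nat) A (f : V -> W) : Prop :=
  (forall x, A x -> differentiable f x) /\
  if m is m'.+1 then forall v, smooth_upto m' A ('D_v f) else True.

Lemma smooth_uptoP (W : normedModType R) A (f : V -> W) :
  smooth_on A f <-> forall m, smooth_upto m A f.
Proof.
split.
- move=> sf m; elim: m f sf => [|m IH] f sf /=.
    by split=> // x Ax; exact: (sf [::]).
  split=> [x Ax|v]; first exact: (sf [::]).
  apply: IH => vs x Ax.
  by have := sf (rcons vs v) x Ax; rewrite foldr_rcons.
(* The last vector of the list is the direction of the first derivative taken, so the list is peeled
   from its end. *)
- move=> sf vs; elim/last_ind: vs f sf => [|vs v IH] f sf x Ax.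
    by have [/(_ x Ax)] := sf 0%N.
  rewrite foldr_rcons; apply: IH => // m.
  exact: (proj2 (sf m.+1)).
Qed.

Lemma smooth_upto_ext (W : normedModType R) m A (f g : V -> W) :
  open A -> (forall x, A x -> f x = g x) ->
  smooth_upto m A f -> smooth_upto m A g.
Proof.
move=> oA; elim: m f g => [|m IH] f g fg /= [df sf]; split=> //.
- by move=> x Ax; apply: near_eq_differentiable (df x Ax); exact: open_near fg.
- by move=> x Ax; apply: near_eq_differentiable (df x Ax); exact: open_near fg.
- by move=> v; apply: IH (sf v) => x Ax; exact: derive_ext fg.
Qed.

Lemma smooth_uptoW (W : normedModType R) m A (f : V -> W) :
  smooth_upto m.+1 A f -> smooth_upto m A f.
Proof.
elim: m f => [|m IH] f [df sf]; split=> //= v.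
by apply: IH; exact: sf.
Qed.

Lemma smooth_upto_diff (W : normedModType R) m A (f : V -> W) x :
  smooth_upto m A f -> A x -> differentiable f x.
Proof. by case: m => [|m] [+ _]; apply. Qed.

Lemma smooth_on_diff (W : normedModType R) A (f : V -> W) x :
  smooth_on A f -> A x -> differentiable f x.
Proof. by move=> /(_ [::] x). Qed.

Lemma smooth_on_derive (W : normedModType R) A (f : V -> W) v :
  smooth_on A f -> smooth_on A ('D_v f).
Proof.
by move=> /smooth_uptoP sf; apply/smooth_uptoP => m; exact: (proj2 (sf m.+1)).
Qed.

Lemma smooth_on_ext (W : normedModType R) A (f g : V -> W) :
  open A -> (forall x, A x -> f x = g x) -> smooth_on A f -> smooth_on A g.
Proof.
move=> oA fg /smooth_uptoP sf; apply/smooth_uptoP => m.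
exact: smooth_upto_ext (sf m).
Qed.

Lemma smooth_upto_cst (W : normedModType R) m A (c : W) :
  smooth_upto m A (fun=> c).
Proof.
have dc (b : W) x : differentiable (fun _ : V => b) x by exact: differentiable_cst.
elim: m c => [|m IH] c; split=> // v.
rewrite [X in smooth_upto _ _ X](_ : _ = fun=> 0); first exact: IH.
by apply/funext => x; exact: derive_cst.
Qed.

Lemma smooth_uptoD m A (f g : V -> R^o) : open A ->
  smooth_upto m A f -> smooth_upto m A g -> smooth_upto m A (fun x => f x + g x).
Proof.
move=> oA; elim: m f g => [|m IH] f g [df sf] [dg sg]; split=> //.
- by move=> x Ax; exact: differentiableD (df x Ax) (dg x Ax).
- by move=> x Ax; exact: differentiableD (df x Ax) (dg x Ax).
- move=> v; apply: smooth_upto_ext (IH _ _ (sf v) (sg v)) => //= x Ax.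
  by rewrite [RHS]deriveD//; apply: diff_derivable; [exact: df|exact: dg].
Qed.

Lemma smooth_uptoM m A (f g : V -> R^o) : open A ->
  smooth_upto m A f -> smooth_upto m A g ->
  smooth_upto m A (fun x => f x * g x : R^o).
Proof.
move=> oA; elim: m f g => [|m IH] f g sf sg.
  by case: sf sg => df _ [dg _]; split=> // x Ax;
    exact: (differentiableM (df x Ax) (dg x Ax)).
split=> [x Ax|v].
  by case: sf sg => df _ [dg _]; exact: (differentiableM (df x Ax) (dg x Ax)).
have s1 := IH _ _ (smooth_uptoW sf) (proj2 sg v).
have s2 := IH _ _ (smooth_uptoW sg) (proj2 sf v).
apply: smooth_upto_ext (smooth_uptoD oA s1 s2) => // x Ax.
rewrite [RHS](@deriveM _ _ f g)//; apply: diff_derivable.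
  exact: smooth_upto_diff sf Ax.
exact: smooth_upto_diff sg Ax.
Qed.

(** The derivative is [- f' (1/f)^2], so order [m.+1] of the inverse needs the inverse itself only
    to order [m]. The square root closes the same loop with [f' / (2 sqrt f)]. *)
Lemma smooth_uptoV m A (f : V -> R^o) : open A ->
  (forall x, A x -> f x != 0) ->
  smooth_upto m A f -> smooth_upto m A (fun x => (f x)^-1 : R^o).
Proof.
move=> oA f0; elim: m => [|m IH] sf.
  by case: sf => df _; split=> // x Ax; apply: differentiableV (df x Ax) (f0 x Ax).
split=> [x Ax|v].
  by case: sf => df _; apply: differentiableV (df x Ax) (f0 x Ax).
have sV := IH (smooth_uptoW sf).
have s := smooth_uptoM oA (smooth_uptoM oA (smooth_upto_cst m A (-1 : R^o))
  (proj2 sf v)) (smooth_uptoM oA sV sV).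
apply: smooth_upto_ext s => // x Ax.
rewrite [RHS](@deriveV _ _ f)//; last 2 first.
- exact: f0.
- by apply: diff_derivable; exact: smooth_upto_diff sf Ax.
by rewrite /GRing.scale /= -expr2 exprVn mulN1r !mulNr mulrC.
Qed.

Lemma smooth_upto_sqrt m A (f : V -> R^o) : open A ->
  (forall x, A x -> 0 < f x) ->
  smooth_upto m A f -> smooth_upto m A (fun x => Num.sqrt (f x) : R^o).
Proof.
move=> oA f0.
have dsq x : A x -> differentiable f x ->
    is_diff x (fun x => Num.sqrt (f x) : R^o)
      (fun v => 'd f x v *: ((2 * Num.sqrt (f x))^-1 : R^o)).
  move=> Ax df.
  have ds := is_derive1_sqrt (f0 x Ax).
  have ds' : differentiable (Num.sqrt : R^o -> R^o) (f x).
    by apply/derivable1_diffP; case: ds.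
  have -> : (fun x => Num.sqrt (f x) : R^o) = (Num.sqrt : R^o -> R^o) \o f by [].
  apply: DiffDef; first exact: differentiable_comp.
  rewrite diff_comp//; apply/funext => v /=.
  rewrite deriv1E; last by case: ds.
  by rewrite derive1E (@derive_val _ _ _ _ _ _ _ ds).
elim: m => [|m IH] sf.
  by case: sf => df _; split=> // x Ax; case: (dsq x Ax (df x Ax)).
split=> [x Ax|v].
  by case: sf => df _; case: (dsq x Ax (df x Ax)).
have sS := IH (smooth_uptoW sf).
have sV : smooth_upto m A (fun x => (2 * Num.sqrt (f x))^-1 : R^o).
  apply: smooth_uptoV => // [x Ax|].
    by rewrite mulf_neq0 ?gt_eqF ?sqrtr_gt0 ?f0.
  exact: smooth_uptoM (smooth_upto_cst m A (2 : R^o)) sS.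
apply: smooth_upto_ext (smooth_uptoM oA (proj2 sf v) sV) => // x Ax.
have dfx := smooth_upto_diff sf Ax.
have [ds dsE] := dsq x Ax dfx.
by rewrite [RHS]deriveE// dsE deriveE.
Qed.

Lemma smooth_on_cst (W : normedModType R) A (c : W) : smooth_on A (fun=> c).
Proof. by apply/smooth_uptoP => m; exact: smooth_upto_cst. Qed.

Lemma smooth_onD A (f g : V -> R^o) : open A ->
  smooth_on A f -> smooth_on A g -> smooth_on A (fun x => f x + g x).
Proof.
move=> oA /smooth_uptoP sf /smooth_uptoP sg; apply/smooth_uptoP => m.
exact: smooth_uptoD.
Qed.

Lemma smooth_onM A (f g : V -> R^o) : open A ->
  smooth_on A f -> smooth_on A g ->
  smooth_on A (fun x => (f x : R) * (g x : R) : R^o).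
Proof.
move=> oA /smooth_uptoP sf /smooth_uptoP sg; apply/smooth_uptoP => m.
exact: smooth_uptoM.
Qed.

Lemma smooth_onV A (f : V -> R^o) : open A -> (forall x, A x -> f x != 0) ->
  smooth_on A f -> smooth_on A (fun x => (f x)^-1 : R^o).
Proof.
move=> oA f0 /smooth_uptoP sf; apply/smooth_uptoP => m.
exact: smooth_uptoV.
Qed.

Lemma smooth_on_sqrt A (f : V -> R^o) : open A -> (forall x, A x -> 0 < f x) ->
  smooth_on A f -> smooth_on A (fun x => Num.sqrt (f x) : R^o).
Proof.
move=> oA f0 /smooth_uptoP sf; apply/smooth_uptoP => m.
exact: smooth_upto_sqrt.
Qed.

Lemma smooth_on_sum A I (r : seq I) (P : pred I) (F : I -> V -> R^o) : open A ->
  (forall i, P i -> smooth_on A (F i)) ->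
  smooth_on A (fun x => \sum_(i <- r | P i) F i x).
Proof.
move=> oA sF; elim: r => [|i r IH].
  rewrite [X in smooth_on _ X](_ : _ = fun=> 0); first exact: smooth_on_cst.
  by apply/funext => x; rewrite big_nil.
have [Pi|Pi] := boolP (P i); last first.
  rewrite [X in smooth_on _ X](_ : _ = fun x => \sum_(i <- r | P i) F i x)//.
  by apply/funext => x; rewrite big_cons (negbTE Pi).
rewrite [X in smooth_on _ X](_ : _ = fun x => F i x + \sum_(i <- r | P i) F i x).
  by apply: smooth_onD => //; exact: sF.
by apply/funext => x; rewrite big_cons Pi.
Qed.

Lemma smooth_on_prod A I (r : seq I) (P : pred I) (F : I -> V -> R^o) : open A ->
  (forall i, P i -> smooth_on A (F i)) ->
  smooth_on A (fun x => \prod_(i <- r | P i) (F i x : R) : R^o).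
Proof.
move=> oA sF; elim: r => [|i r IH].
  rewrite [X in smooth_on _ X](_ : _ = fun=> 1); first exact: smooth_on_cst.
  by apply/funext => x; rewrite big_nil.
have [Pi|Pi] := boolP (P i); last first.
  rewrite [X in smooth_on _ X](_ : _ = fun x => \prod_(i <- r | P i) (F i x:R))//.
  by apply/funext => x; rewrite big_cons (negbTE Pi).
rewrite [X in smooth_on _ X](_ : _ =
  fun x => (F i x : R) * \prod_(i <- r | P i) (F i x : R)).
  by apply: smooth_onM => //; exact: sF.
by apply/funext => x; rewrite big_cons Pi.
Qed.

Lemma smooth_on_det A m (G : V -> 'M[R]_m) : open A ->
  (forall a b, smooth_on A (fun x => G x a b : R^o)) ->
  smooth_on A (fun x => \det (G x) : R^o).
Proof.
move=> oA sG; apply: smooth_on_sum => // s _.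
apply: smooth_onM => //; first exact: smooth_on_cst.
exact: smooth_on_prod.
Qed.

Lemma smooth_on_invmx A m (G : V -> 'M[R]_m) : open A ->
  (forall x, A x -> G x \in unitmx) ->
  (forall a b, smooth_on A (fun x => G x a b : R^o)) ->
  forall a b, smooth_on A (fun x => invmx (G x) a b : R^o).
Proof.
move=> oA uG sG a b.
(* Cramer's rule reduces the inverse to determinants and one scalar inverse. *)
apply: (@smooth_on_ext _ _ (fun x => (\det (G x))^-1 * cofactor (G x) b a)) => //.
  by move=> x Ax; rewrite /invmx uG// !mxE.
apply: smooth_onM => //.
  apply: smooth_onV => //; last exact: smooth_on_det.
  by move=> x /uG; rewrite unitmxE unitfE.
apply: smooth_onM => //; first exact: smooth_on_cst.
apply: smooth_on_det => // c d.
rewrite [X in smooth_on _ X](_ : _ = fun x => G x (lift b c) (lift a d))//.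
by apply/funext => x; rewrite !mxE.
Qed.

(** Meant for the orientation sign, which is locally constant by continuity. *)
Lemma smooth_on_locally_cst A (f : V -> R^o) : open A ->
  (forall x, A x -> \forall y \near x, f y = f x) -> smooth_on A f.
Proof.
move=> oA fc; apply/smooth_uptoP => m.
have dcst x : A x -> differentiable f x.
  move=> Ax; apply: (@near_eq_differentiable _ (fun=> f x)).
    by apply: filterS (fc x Ax) => y ->.
  exact: differentiable_cst.
case: m => [|m]; split=> // v.
apply: (@smooth_upto_ext _ _ _ (fun=> 0)) => //; last exact: smooth_upto_cst.
move=> x Ax; rewrite (near_eq_derive (g := fun=> f x)); last exact: fc.
by rewrite derive_cst.
Qed.

End SmoothCalculus.

(** * Symmetry of second derivatives *)

Section Schwarz.
Context {R : realType} {V : normedModType R}.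
Implicit Types (A : set V) (f : V -> R^o) (v w x y : V).

Lemma is_derive_line f y v (s : R) : differentiable f (y + s *: v) ->
  is_derive s 1 (fun s : R => f (y + s *: v) : R) ('D_v f (y + s *: v)).
Proof.
move=> df.
pose l := cst y + ( *:%R ^~ v) : R -> V.
have dl : is_diff (s : R^o) (l : R^o -> V) (0 + ( *:%R ^~ v)).
  exact: is_diffD.
have df' : is_diff (l s) f ('d f (l s)) by apply: DiffDef.
have dfl : is_diff (s : R^o) (f \o (l : R^o -> V)) ('d f (l s) \o (0 + ( *:%R ^~ v))).
  exact: is_diff_comp.
have -> : (fun s : R => f (y + s *: v) : R) = f \o l by [].
have dfl' : differentiable (f \o (l : R^o -> V)) s by case: dfl.
apply: DeriveDef; first exact: diff_derivable.
rewrite [LHS]deriveE// [LHS](congr1 (fun g => g 1) (@diff_val _ _ _ _ _ _ _ dfl)).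
by rewrite /= [X in 'd f _ X](_ : _ = v) ?deriveE//= -[RHS]scale1r -[RHS]add0r.
Qed.

Lemma MVT_line f y v (t : R) : 0 < t ->
  (forall s, 0 <= s <= t -> differentiable f (y + s *: v)) ->
  exists2 s, 0 <= s <= t & f (y + t *: v) - f y = 'D_v f (y + s *: v) * t.
Proof.
move=> t0 df.
have [|||s sI E] := @MVT R (fun s => f (y + s *: v))
    (fun s => 'D_v f (y + s *: v)) 0 t.
- exact: t0.
- move=> s; rewrite in_itv/= => /andP[s0 st].
  by apply: is_derive_line; apply: df; rewrite !ltW.
- apply: derivable_within_continuous => s; rewrite in_itv/= => sI.
  by have [] := is_derive_line (df s sI).
exists s; last by move: E; rewrite scale0r addr0 subr0.
by move: sI; rewrite in_itv/= => /andP[? ?]; rewrite !ltW.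
Qed.

Lemma near_parallelogram x v w (P : V -> Prop) : (\forall y \near x, P y) ->
  exists2 r : R, 0 < r & forall a b, 0 <= a <= r -> 0 <= b <= r ->
    P (x + a *: v + b *: w).
Proof.
move=> /nbhs_ballP[e /= e0 eP].
have c0 : 0 < `|v| + `|w| + 1 by rewrite ltr_wpDl// addr_ge0.
(* The summand [1] keeps the denominator positive when [v] and [w] both vanish. *)
exists (e / (`|v| + `|w| + 1)); first by rewrite divr_gt0.
move=> a b /andP[a0 ar] /andP[b0 br]; apply: eP.
rewrite -ball_normE/= -addrA opprD addrA subrr add0r normrN.
apply: le_lt_trans (ler_normD _ _) _; rewrite !normrZ !ger0_norm//.
have -> : e = e / (`|v| + `|w| + 1) * (`|v| + `|w| + 1) by rewrite divfK// gt_eqF.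
apply: (@le_lt_trans _ _ (e / (`|v| + `|w| + 1) * (`|v| + `|w|))).
  by rewrite mulrDr lerD// ler_wpM2r.
by rewrite ltr_pM2l ?ltrDl// divr_gt0.
Qed.

(** The second difference is the increment along [v] of [f (y + t w) - f y]. The mean value theorem
    turns it into [t] times an increment of ['D_v f] along [w], to which the theorem applies
    again. *)
Lemma second_difference_MVT A f x v w (t : R) : smooth_on A f -> 0 < t ->
  (forall a b, 0 <= a <= t -> 0 <= b <= t -> A (x + a *: v + b *: w)) ->
  exists a b, [/\ 0 <= a <= t, 0 <= b <= t &
    f (x + t *: v + t *: w) - f (x + t *: v) - (f (x + t *: w) - f x) =
    'D_w ('D_v f) (x + a *: v + b *: w) * t * t].
Proof.
move=> sf t0 At.
have tt : 0 <= t <= t by rewrite ltW /=.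
have sAt a : 0 <= a <= t -> A (x + a *: v).
  move=> at_; rewrite -[x + _]addr0 -(scale0r w); apply: At => //.
  by apply/andP; split=> //; exact: ltW.
pose ft : V -> R^o := f \o (fun y => y + t *: w).
have dsh y : is_diff y (fun y => y + t *: w) (id + 0) by exact: is_diffD.
have dfs a : 0 <= a <= t ->
    is_diff (x + a *: v) ft ('d f (x + a *: v + t *: w)).
  move=> at_; have dfa := smooth_on_diff sf (At _ _ at_ tt).
  have df' : is_diff (x + a *: v + t *: w) f ('d f (x + a *: v + t *: w)) by [].
  have H : is_diff (x + a *: v) ft ('d f (x + a *: v + t *: w) \o (id + 0)).
    exact: is_diff_comp.
  by apply: is_diff_eq H _; apply/funext => u /=; rewrite -[in RHS](addr0 u).
have [|a aI E] := @MVT_line (ft - f) x v t t0.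
  move=> a aI; apply: differentiableB; first by case: (dfs a aI).
  exact: smooth_on_diff sf (sAt _ aI).
have [|b bI E'] := @MVT_line ('D_v f) (x + a *: v) w t t0.
  move=> b bI; apply: smooth_on_diff (At _ _ aI bI).
  exact: smooth_on_derive.
exists a, b; split=> //; rewrite -E' {E'}.
rewrite -[LHS]/((ft - f) (x + t *: v) - (ft - f) x).
have [dfa dfE] := dfs a aI.
rewrite [LHS]E deriveB; last 2 first.
- exact: diff_derivable.
- by apply: diff_derivable; exact: smooth_on_diff sf (sAt _ aI).
have ftE : 'D_v ft (x + a *: v) = 'D_v f (x + a *: v + t *: w).
  by rewrite (deriveE v dfa) dfE (deriveE v (smooth_on_diff sf (At _ _ aI tt))).
exact: (congr1 (fun z : R => (z - 'D_v f (x + a *: v)) * t) ftE).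
Qed.

(** The second difference is symmetric in [v] and [w]. Dividing it by [r * r] gives a value of one
    mixed derivative and also a value of the other, at points close to [x]; continuity of both at
    [x] concludes. *)
Lemma derive_comm A f x v w : open A -> smooth_on A f -> A x ->
  'D_v ('D_w f) x = 'D_w ('D_v f) x.
Proof.
move=> oA sf Ax; have close (a b : R) :
    (forall e, 0 < e -> exists2 c, `|a - c| < e / 2 & `|b - c| < e / 2) -> a = b.
  move=> ab; apply/eqP; rewrite -subr_eq0 -normr_le0.
  apply/ler_addgt0Pr => e /ab[c ac bc]; rewrite add0r [e]splitr.
  apply: le_trans (ler_distD c _ _) _; rewrite (distrC c).
  by apply: lerD; apply: ltW.
apply: close => e e0.
have e20 : 0 < e / 2 by rewrite divr_gt0.
have c1 : {for x, continuous ('D_v ('D_w f))}.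
  apply: differentiable_continuous; apply: smooth_on_diff Ax.
  by do 2!apply: smooth_on_derive.
have c2 : {for x, continuous ('D_w ('D_v f))}.
  apply: differentiable_continuous; apply: smooth_on_diff Ax.
  by do 2!apply: smooth_on_derive.
have n1 : \forall y \near x,
    `|'D_v ('D_w f) x - 'D_v ('D_w f) y| < e / 2.
  exact: (cvgrPdist_lt _ _).1 c1 _ e20.
have n2 : \forall y \near x,
    `|'D_w ('D_v f) x - 'D_w ('D_v f) y| < e / 2.
  exact: (cvgrPdist_lt _ _).1 c2 _ e20.
have n3 : \forall y \near x, A y by exact: open_nbhs_nbhs.
have [r r0 rP] := near_parallelogram v w (filterI n3 (filterI n1 n2)).
have [|a [b [aI bI E1]]] := @second_difference_MVT A f x v w r sf r0.
  by move=> a b aI bI; case: (rP a b aI bI).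
have [|b' [a' [b'I a'I E2]]] := @second_difference_MVT A f x w v r sf r0.
  by move=> a' b' a'I b'I; rewrite addrAC; case: (rP b' a' b'I a'I).
have E : 'D_w ('D_v f) (x + a *: v + b *: w)
    = 'D_v ('D_w f) (x + a' *: v + b' *: w).
  (* Exchanging [v] and [w] swaps the two middle terms [b2] and [b3] of the second difference. *)
  have can (a1 a2 b1 b2 b3 b4 : R) : b1 - b2 - (b3 - b4) = a1 * r * r ->
      b1 - b3 - (b2 - b4) = a2 * r * r -> a1 = a2.
    have r0' : r != 0 by rewrite gt_eqF.
    move=> e1 e2; apply: (mulIf r0'); apply: (mulIf r0'); rewrite -e1 -e2.
    by rewrite !opprB addrACA [RHS]addrACA (addrC (- b2)).
  rewrite (addrAC x (r *: w)) (addrAC x (b' *: w)) in E2.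
  exact: can E1 E2.
have [_ [_ /= d2]] := rP a b aI bI.
have [_ [/= d1 _]] := rP a' b' a'I b'I.
exists ('D_v ('D_w f) (x + a' *: v + b' *: w)); first exact: d1.
by rewrite -E; exact: d2.
Qed.

End Schwarz.

(** * Alternating sums and multicovectors *)

Section AlternatingSum.
Context {R : realType} {V : zmodType}.
Implicit Types (H : V -> seq V -> R) (vs ws : seq V).

(** The pattern of the formula for [d], with [H] fed the removed vector and the remaining list.
    Keeping [H] abstract makes the cancellation of second derivatives pure combinatorics. *)
Definition alt_sum H vs : R :=
  \sum_(l < size vs) (-1) ^+ l * H (nth 0 vs l) (take l vs ++ drop l.+1 vs).

Lemma alt_sum_nil H : alt_sum H [::] = 0.
Proof. by rewrite /alt_sum big_ord0. Qed.

Lemma alt_sum_cons H v vs :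
  alt_sum H (v :: vs) = H v vs - alt_sum (fun u ws => H u (v :: ws)) vs.
Proof.
rewrite /alt_sum /= big_ord_recl /= expr0 mul1r drop0; congr (_ + _).
rewrite -sumrN; apply: eq_bigr => l _.
by rewrite /= exprS mulN1r mulNr.
Qed.

Lemma eq_alt_sum H H' vs : (forall v ws, H v ws = H' v ws) ->
  alt_sum H vs = alt_sum H' vs.
Proof. by move=> HH'; apply: eq_bigr => l _; rewrite HH'. Qed.

Lemma alt_sum0 H vs : (forall v ws, H v ws = 0) -> alt_sum H vs = 0.
Proof. by move=> H0; rewrite /alt_sum big1// => l _; rewrite H0 mulr0. Qed.

Lemma alt_sum_lin a H H' vs :
  alt_sum (fun v ws => a * H v ws + H' v ws) vs = a * alt_sum H vs + alt_sum H' vs.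
Proof.
rewrite /alt_sum mulr_sumr -big_split; apply: eq_bigr => l _ /=.
by rewrite mulrDr mulrCA.
Qed.

Lemma alt_sum_sumr (I : finType) (c : I -> R) (H : I -> V -> seq V -> R) vs :
  alt_sum (fun v ws => \sum_i c i * H i v ws) vs = \sum_i c i * alt_sum (H i) vs.
Proof.
rewrite /alt_sum; under [RHS]eq_bigr do rewrite mulr_sumr.
rewrite exchange_big /=; apply: eq_bigr => l _.
by rewrite mulr_sumr; apply: eq_bigr => i _; rewrite mulrCA.
Qed.

Lemma alt_sum_map (T : zmodType) (c : T -> V) H (vs : seq T) :
  alt_sum H (map c vs) =
  \sum_(l < size vs) (-1) ^+ l * H (c (nth 0 vs l)) (map c (take l vs ++ drop l.+1 vs)).
Proof.
rewrite /alt_sum size_map; apply: eq_bigr => l _.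
by rewrite (nth_map 0)// map_cat map_take map_drop.
Qed.

(** Peel off the head [v]: the terms removing [v] first cancel, by symmetry of [K], those removing
    it second, and the terms keeping [v] vanish by induction. This serves both for [d d = 0] and for
    the second derivatives of a transition map. *)
Lemma alt_sum_sym0 (K : V -> V -> seq V -> R) vs :
  (forall u v ws, K u v ws = K v u ws) ->
  alt_sum (fun v ws => alt_sum (K v) ws) vs = 0.
Proof.
elim: vs K => [|v vs IH] K Ksym; first exact: alt_sum_nil.
rewrite alt_sum_cons.
have -> : alt_sum (fun u ws => alt_sum (K u) (v :: ws)) vs
    = -1 * alt_sum (fun u ws => alt_sum (fun u' r => K u u' (v :: r)) ws) vs
      + alt_sum (K v) vs.
  rewrite -alt_sum_lin; apply: eq_alt_sum => u ws.
  by rewrite alt_sum_cons Ksym mulN1r addrC.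
rewrite (IH (fun u u' r => K u u' (v :: r))); last by move=> *; exact: Ksym.
by rewrite mulr0 add0r subrr.
Qed.

End AlternatingSum.

Section Alternating.
Context {R : realType} {n : nat}.
Local Notation V := 'rV[R]_n.
Implicit Types (w : @multicovector R n) (s t r : seq V) (u v : V).

Lemma alternating_add w s t u v : is_alternating w ->
  w (s ++ (u + v) :: t) = w (s ++ u :: t) + w (s ++ v :: t).
Proof. by case=> + _ => /(_ s t 1 u v); rewrite scale1r mul1r. Qed.

Lemma alternating0 w s t : is_alternating w -> w (s ++ 0 :: t) = 0.
Proof.
move=> aw; apply/(@addrI _ (w (s ++ 0 :: t))).
by rewrite -alternating_add// !addr0.
Qed.



Lemma alternating_sum w s t (I : finType) (c : I -> R) (e : I -> V) :
  is_alternating w ->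
  w (s ++ (\sum_i c i *: e i) :: t) = \sum_i c i * w (s ++ e i :: t).
Proof.
move=> aw; elim/big_rec2: _ => [|i x y _ <-]; first exact: alternating0.
by rewrite (proj1 aw).
Qed.

Lemma alternating_swap w s t u v : is_alternating w ->
  w (s ++ u :: v :: t) = - w (s ++ v :: u :: t).
Proof.
move=> aw; apply/eqP; rewrite -addr_eq0; apply/eqP.
have := proj2 aw s [::] t (u + v); rewrite /= (alternating_add _ _ _ _ aw).
rewrite -!(cat_rcons _ s) !(alternating_add _ _ _ _ aw) !cat_rcons.
have rep z : w (s ++ z :: z :: t) = 0 by exact: (proj2 aw s [::] t z).
by rewrite !rep add0r addr0.
Qed.

Lemma alternating_move w s t r u : is_alternating w ->
  w (s ++ u :: t ++ r) = (-1) ^+ size t * w (s ++ t ++ u :: r).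
Proof.
move=> aw; elim: t s => [|v t IH] s /=; first by rewrite mul1r.
by rewrite alternating_swap// -cat_rcons IH cat_rcons exprS mulN1r mulNr.
Qed.

Lemma alternating_cat w s : is_alternating w ->
  is_alternating (fun vs => w (s ++ vs)).
Proof.
move=> aw; split=> [s' t a u v|s' t r u].
  by rewrite !catA (proj1 aw).
by rewrite catA (proj2 aw).
Qed.

Lemma alternating_cons w v : is_alternating w ->
  is_alternating (fun vs => w (v :: vs)).
Proof. exact: (@alternating_cat w [:: v]). Qed.

Lemma row_frame_sum v : v = \sum_a v ord0 a *: frame_vec a.
Proof.
by rewrite [LHS]matrix_sum_delta big_ord_recl big_ord0 addr0.
Qed.

(* Transposing the first two arguments absorbs the sign of [alt_sum_cons]. *)
Lemma alternating_cons_alt_sum w v (B c : V -> V) s : is_alternating w ->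
  alt_sum (fun u r => w (B u :: map c r)) (v :: s) =
  w (B v :: map c s) + alt_sum (fun u r => w (c v :: B u :: map c r)) s.
Proof.
move=> aw; rewrite alt_sum_cons; congr (_ + _).
rewrite -mulN1r -[LHS]addr0 -(@alt_sum0 R V (fun _ _ => 0) s)// -alt_sum_lin.
apply: eq_alt_sum => u r /=; rewrite addr0 mulN1r.
by rewrite (@alternating_swap w [::])// opprK.
Qed.

End Alternating.

(** * The exterior derivative in a chart *)

Section LocalDifferential.
Context {R : realType} {n : nat}.
Local Notation V := 'rV[R]_n.
Implicit Types (A B : set V) (x u v : V) (vs ws : seq V).

Definition local_d (F : V -> seq V -> R) x vs : R :=
  alt_sum (fun v ws => 'D_v (fun y => F y ws : R^o) x) vs.

Lemma derive_lin A (f f1 f2 : V -> R^o) a v x : open A -> A x ->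
  differentiable f1 x -> differentiable f2 x ->
  (forall y, A y -> f y = a * f1 y + f2 y) ->
  'D_v f x = a * 'D_v f1 x + 'D_v f2 x.
Proof.
move=> oA Ax d1 d2 fE.
have dv1 : derivable f1 x v by exact: diff_derivable.
have dv2 : derivable f2 x v by exact: diff_derivable.
have fE' y : A y -> f y = (a \*: f1 + f2) y by exact: fE.
have dvZ : derivable (a \*: f1) x v by exact: derivableZ.
by rewrite (derive_ext v oA Ax fE') (deriveD dvZ dv2) (deriveZ a dv1).
Qed.

Lemma derive_sumr (I : finType) (c : I -> R) (f : I -> V -> R^o) A g v x :
  open A -> A x -> (forall i, differentiable (f i) x) ->
  (forall y, A y -> g y = \sum_i c i * f i y) ->
  differentiable (g : V -> R^o) x /\ 'D_v (g : V -> R^o) x = \sum_i c i * 'D_v (f i) x.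
Proof.
move=> oA Ax df gE.
suff [dS DS] : differentiable (fun y => \sum_i c i * f i y : R^o) x /\
    'D_v (fun y => \sum_i c i * f i y : R^o) x = \sum_i c i * 'D_v (f i) x.
  split; last by rewrite (derive_ext v oA Ax gE).
  by apply: near_eq_differentiable dS; apply: (open_near oA Ax) => y /gE.
elim: (index_enum I) => [|i r [dr Dr]].
  rewrite [X in differentiable X _](_ : _ = fun=> 0); last first.
    by apply/funext => y; rewrite big_nil.
  rewrite [X in derive X _ _](_ : _ = fun=> 0); last first.
    by apply/funext => y; rewrite big_nil.
  by rewrite big_nil derive_cst; split=> //; exact: differentiable_cst.
rewrite [X in differentiable X _](_ : _ =
    (c i \*: f i : V -> R^o) + (fun y => \sum_(j <- r) c j * f j y : R^o)); last first.
  by apply/funext => y; rewrite big_cons.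
rewrite [X in derive X _ _](_ : _ =
    (c i \*: f i : V -> R^o) + (fun y => \sum_(j <- r) c j * f j y : R^o)); last first.
  by apply/funext => y; rewrite big_cons.
have di : differentiable (c i \*: f i : V -> R^o) x by exact: differentiableZ.
split; first exact: differentiableD.
have dvi : derivable (f i) x v by exact: diff_derivable.
have dvZ : derivable (c i \*: f i) x v by exact: derivableZ.
have dvr := @diff_derivable _ _ _ _ _ v dr.
by rewrite (deriveD dvZ dvr) (deriveZ _ dvi) big_cons Dr.
Qed.

Lemma smooth_on_coord A (phi : V -> V) a : open A ->
  smooth_on A phi -> smooth_on A (fun y => phi y ord0 a : R^o).
Proof.
move=> oA /smooth_uptoP sphi; apply/smooth_uptoP => m.
elim: m phi {sphi}(sphi m) => [|m IH] phi sphi.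
  split=> // y Ay; have dphi := smooth_upto_diff sphi Ay.
  exact: (differentiable_comp dphi (differentiable_coord _ _ _)).
split=> [y Ay|v].
  have dphi := smooth_upto_diff sphi Ay.
  exact: (differentiable_comp dphi (differentiable_coord _ _ _)).
apply: smooth_upto_ext (IH _ (proj2 sphi v)) => // y Ay.
rewrite derive_mx ?mxE//.
by apply: diff_derivable; exact: smooth_upto_diff sphi Ay.
Qed.

Lemma local_d_cons F x v vs : local_d F x (v :: vs) =
  'D_v (fun y => F y vs : R^o) x - local_d (fun y ws => F y (v :: ws)) x vs.
Proof. exact: alt_sum_cons. Qed.

Lemma local_d_lin A F F1 F2 a x vs : open A -> A x ->
  (forall ws, differentiable (fun y => F1 y ws : R^o) x) ->
  (forall ws, differentiable (fun y => F2 y ws : R^o) x) ->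
  (forall y, A y -> forall ws, F y ws = a * F1 y ws + F2 y ws) ->
  local_d F x vs = a * local_d F1 x vs + local_d F2 x vs.
Proof.
move=> oA Ax d1 d2 FE; rewrite /local_d -alt_sum_lin; apply: eq_alt_sum => v ws.
by apply: (derive_lin _ oA Ax (d1 ws) (d2 ws)) => y Ay; exact: FE.
Qed.

Lemma local_d_ext A F G x vs : open A -> A x ->
  (forall y, A y -> forall ws, F y ws = G y ws) -> local_d F x vs = local_d G x vs.
Proof.
move=> oA Ax FG; apply: eq_alt_sum => v ws.
by apply: (derive_ext v oA Ax) => y Ay; exact: FG.
Qed.

(* Every term of the sum that differentiates along a vector other than [s] has
   [s] among the arguments of [F]. *)
Lemma local_d_vanish A F s x : open A -> A x ->
  (forall y, A y -> forall t r, F y (t ++ s :: r) = 0) ->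
  forall t r, local_d F x (t ++ s :: r) =
    (-1) ^+ size t * 'D_s (fun y => F y (t ++ r) : R^o) x.
Proof.
move=> oA Ax F0 t r; elim: t F F0 => [|v t IH] F F0 /=; rewrite local_d_cons.
  rewrite mul1r [X in _ - X](_ : _ = 0) ?subr0//.
  apply: alt_sum0 => v ws; rewrite (derive_ext (g := fun=> 0) v oA Ax).
    exact: derive_cst.
  by move=> y Ay; exact: (F0 y Ay [::]).
rewrite IH; last by move=> y Ay t' r'; exact: (F0 y Ay (v :: t')).
rewrite (derive_ext (g := fun=> 0) v oA Ax); last by move=> y Ay; exact: F0.
by rewrite [X in X - _](@derive_cst _ _ R^o) sub0r exprS mulN1r mulNr.
Qed.

(** In the term that differentiates along the varying slot, linearity is that of the differential in
    its direction; in the other terms it is that of [F y] in its argument. *)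
Lemma local_d_linear A F x s t a u v : open A -> A x ->
  (forall y, A y -> is_alternating (F y)) ->
  (forall ws, differentiable (fun y => F y ws : R^o) x) ->
  local_d F x (s ++ (a *: u + v) :: t) =
  a * local_d F x (s ++ u :: t) + local_d F x (s ++ v :: t).
Proof.
move=> oA Ax; elim: s F => [|w s IH] F aF dF /=; rewrite !local_d_cons.
  rewrite (@local_d_lin A _ (fun y ws => F y (u :: ws))
    (fun y ws => F y (v :: ws)) a)//; last first.
    by move=> y Ay ws; exact: (proj1 (aF y Ay) [::]).
  rewrite !(deriveE _ (dF t)) linearP mulrBr opprD !addrA; congr (_ - _).
  by rewrite -!addrA; congr (_ + _); exact: addrC.
rewrite IH//; last first.
  by move=> y Ay; apply: alternating_cons; exact: aF.
rewrite (derive_lin (f1 := fun y => F y (s ++ u :: t))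
  (f2 := fun y => F y (s ++ v :: t)) (a := a) w oA Ax (dF _) (dF _)).
  rewrite mulrBr opprD !addrA; congr (_ - _).
  by rewrite -!addrA; congr (_ + _); exact: addrC.
by move=> y Ay; exact: (proj1 (aF y Ay)).
Qed.

Lemma local_d_alternating A F x : open A -> A x ->
  (forall y, A y -> is_alternating (F y)) ->
  (forall ws, differentiable (fun y => F y ws : R^o) x) ->
  is_alternating (local_d F x).
Proof.
move=> oA Ax aF dF; split=> [s t a u v|s t r u].
  exact: (local_d_linear s t a u v oA Ax aF dF).
elim: s F aF dF => [|v s IH] F aF dF /=; rewrite local_d_cons; last first.
  rewrite IH//; last by move=> y Ay; apply: alternating_cons; exact: aF.
  rewrite subr0 (derive_ext (g := fun=> 0) v oA Ax); first exact: derive_cst.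
  by move=> y Ay; exact: (proj2 (aF y Ay)).
(* Only the two terms differentiating along a copy of [u] survive. Moving [u] across [t] produces
   the sign [(-1) ^+ size t] that makes them cancel. *)
rewrite (local_d_vanish oA Ax); last first.
  by move=> y Ay t' r'; exact: (proj2 (aF y Ay) [::]).
have d0 : differentiable (fun _ : V => 0 : R^o) x by exact: differentiable_cst.
rewrite (derive_lin (f1 := fun y => F y (u :: t ++ r)) (f2 := fun=> 0)
  (a := (-1) ^+ size t) u oA Ax (dF _) d0).
  by rewrite [X in _ + X - _](@derive_cst _ _ R^o) addr0; exact: subrr.
move=> y Ay; rewrite addr0 (@alternating_move _ _ _ [::])//; last exact: aF.
by rewrite mulrA -exprD addnn -mul2n exprM sqrrN !expr1n mul1r.
Qed.

Lemma local_d_homogeneous A F k x : open A -> A x ->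
  (forall y, A y -> homogeneous k (F y)) -> homogeneous k.+1 (local_d F x).
Proof.
move=> oA Ax hF vs szvs; rewrite /local_d /alt_sum big1// => l _.
rewrite (derive_ext (g := fun=> 0) _ oA Ax).
  by rewrite [X in _ * X](@derive_cst _ _ R^o) mulr0.
move=> y Ay; apply: hF => //; rewrite size_cat size_take size_drop ltn_ord => e.
by apply: szvs; rewrite -e subnS -addnS prednK ?subn_gt0// subnKC// ltnW.
Qed.

Lemma local_d_smooth A F vs : open A ->
  (forall ws, smooth_on A (fun y => F y ws : R^o)) ->
  smooth_on A (fun x => local_d F x vs : R^o).
Proof.
move=> oA sF; apply: smooth_on_sum => // l _.
apply: smooth_onM => //; first exact: smooth_on_cst.
exact: smooth_on_derive.
Qed.

(** Pulling the outer derivative through the inner finite sum leaves a double alternating sum of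
    second derivatives, whose kernel is symmetric by [derive_comm]. *)
Lemma local_d_local_d A F x vs : open A -> A x ->
  (forall ws, smooth_on A (fun y => F y ws : R^o)) ->
  local_d (local_d F) x vs = 0.
Proof.
move=> oA Ax sF; rewrite -[RHS](@alt_sum_sym0 _ _
  (fun u v ws => 'D_u ('D_v (fun y => F y ws : R^o)) x) vs).
  apply: eq_alt_sum => v ws.
  apply: (proj2 (derive_sumr _ oA Ax _ _)) => [l|//].
  by apply: smooth_on_diff Ax; exact: smooth_on_derive.
by move=> u v ws; exact: derive_comm (sF ws) Ax.
Qed.

End LocalDifferential.

(** * Compatibility of the local differential with pullback *)

Section Pullback.
Context {R : realType} {n : nat}.
Local Notation V := 'rV[R]_n.
Implicit Types (u v : V) (us : seq V).
Variables (A B : set V) (phi : V -> V) (x : V).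
Hypotheses (oA : open A) (oB : open B) (Ax : A x).
Hypothesis phiAB : forall y, A y -> B (phi y).
Hypothesis dphi : differentiable phi x.

(* [F] evaluated at moving vectors [C u y]: expanding the first of them in the
   basis reduces the product rule to one argument at a time. *)
Lemma derive_pullback (C : V -> V -> V) (F : V -> seq V -> R) v us :
  (forall u, differentiable (C u) x) ->
  (forall z, B z -> is_alternating (F z)) ->
  (forall ws z, B z -> differentiable (fun z => F z ws : R^o) z) ->
  differentiable (fun y => F (phi y) [seq C u y | u <- us] : R^o) x /\
  'D_v (fun y => F (phi y) [seq C u y | u <- us] : R^o) x =
    'D_('D_v phi x) (fun z => F z [seq C u x | u <- us] : R^o) (phi x) +
    alt_sum (fun u r => F (phi x) ('D_v (C u) x :: [seq C u' x | u' <- r])) us.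
Proof.
move=> dC; elim: us F => [|u us IH] F aF dF /=.
  have dF' := dF [::] _ (phiAB Ax).
  have dcomp : differentiable ((fun z => F z [::] : R^o) \o phi) x.
    exact: differentiable_comp.
  split; first exact: dcomp.
  rewrite alt_sum_nil addr0 [LHS](deriveE v dcomp) diff_comp//=.
  by rewrite (deriveE _ dF') (deriveE _ dphi).
pose g a y : R := F (phi y) (frame_vec a :: [seq C u y | u <- us]).
have {IH} IH a := IH (fun z ws => F z (frame_vec a :: ws))
  (fun z Bz => alternating_cons (frame_vec a) (aF z Bz))
  (fun ws z Bz => dF (frame_vec a :: ws) z Bz).
have dCa a : differentiable (fun y => C u y ord0 a : R^o) x.
  exact: (differentiable_comp (dC u) (differentiable_coord _ _ _)).
have DCa a : 'D_v (fun y => C u y ord0 a : R^o) x = 'D_v (C u) x ord0 a.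
  by rewrite derive_mx ?mxE//; exact: diff_derivable.
have dg a : differentiable (g a : V -> R^o) x by exact: (proj1 (IH a)).
have expand z w ws : B z ->
    F z (w :: ws) = \sum_a w ord0 a * F z (frame_vec a :: ws).
  move=> Bz; rewrite {1}(row_frame_sum w).
  exact: (@alternating_sum _ _ _ [::] ws _ _ _ (aF z Bz)).
have [|dS DS] := @derive_sumr R n _ (fun=> 1) (fun a y => C u y ord0 a * g a y : R^o) A
  (fun y => F (phi y) (C u y :: [seq C u y | u <- us])) v x oA Ax
  (fun a => differentiableM (dCa a) (dg a)).
  move=> y Ay; rewrite expand; last exact: phiAB.
  by apply: eq_bigr => a _; rewrite mul1r.
split; first exact: dS.
have Da a : 'D_v (fun y => C u y ord0 a * g a y : R^o) x =
    'D_v (C u) x ord0 a * g a x + C u x ord0 a * 'D_v (g a : V -> R^o) x.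
  have dva : derivable (fun y => C u y ord0 a : R^o) x v by exact: diff_derivable.
  have dvg : derivable (g a : V -> R^o) x v by exact: diff_derivable.
  rewrite [LHS](deriveM dva dvg) DCa [RHS]addrC; congr (_ + _).
  exact: mulrC.
rewrite [LHS]DS; under eq_bigr do rewrite mul1r Da.
(* The sums over [a] are now folded back: one part differentiates the first moving vector, and the
   induction hypothesis splits the other into the motion of the base point and that of the later
   vectors. *)
rewrite big_split /= alternating_cons_alt_sum; last exact: aF (phiAB Ax).
rewrite [RHS]addrCA; congr (_ + _); first by rewrite [RHS]expand//; exact: phiAB.
under eq_bigr do rewrite (proj2 (IH _)) mulrDr.
rewrite big_split /=; congr (_ + _).
  apply/esym; apply: (proj2 (derive_sumr _ oB (phiAB Ax) _ _)) => [a|z Bz].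
    exact: dF (phiAB Ax).
  exact: expand.
rewrite -alt_sum_sumr; apply: eq_alt_sum => w r.
by rewrite expand//; exact: phiAB.
Qed.

(* The terms with second derivatives of [phi] cancel because these are
   symmetric while the sum is alternating. *)
Lemma local_d_pullback (F : V -> seq V -> R) us : smooth_on A phi ->
  (forall z, B z -> is_alternating (F z)) ->
  (forall ws, smooth_on B (fun z => F z ws : R^o)) ->
  local_d (fun y ws => F (phi y) [seq 'D_u phi y | u <- ws]) x us =
  local_d F (phi x) [seq 'D_u phi x | u <- us].
Proof.
move=> sphi aF sF.
have dC u : differentiable ('D_u phi) x.
  by apply: smooth_on_diff Ax; exact: smooth_on_derive.
have dF ws z : B z -> differentiable (fun z => F z ws : R^o) z.
  by move=> Bz; exact: smooth_on_diff Bz.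
have Dsym u v : 'D_u ('D_v phi) x = 'D_v ('D_u phi) x.
  (* [derive_comm] concerns real-valued functions, so symmetry is obtained coordinate by
     coordinate. *)
  apply/rowP => a.
  have DDE w w' : ('D_w ('D_w' phi) x) ord0 a =
      'D_w ('D_w' (fun y => phi y ord0 a : R^o)) x.
    rewrite derive_mx ?mxE; last by apply: diff_derivable; exact: dC.
    apply: (derive_ext w oA Ax) => y Ay.
    rewrite derive_mx ?mxE//.
    by apply: diff_derivable; exact: smooth_on_diff Ay.
  have C := @derive_comm R V A _ x u v oA (smooth_on_coord a oA sphi) Ax.
  exact: etrans (DDE u v) (etrans C (esym (DDE v u))).
have E v ws : 'D_v (fun y => F (phi y) [seq 'D_u phi y | u <- ws] : R^o) x =
    1 * alt_sum (fun u r =>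
      F (phi x) ('D_v ('D_u phi) x :: [seq 'D_u' phi x | u' <- r])) ws
    + 'D_('D_v phi x) (fun z => F z [seq 'D_u phi x | u <- ws] : R^o) (phi x).
  rewrite mul1r addrC.
  exact: (proj2 (derive_pullback (C := fun u => 'D_u phi) v ws dC aF dF)).
rewrite /local_d (eq_alt_sum _ E) alt_sum_lin alt_sum_sym0 ?mulr0 ?add0r.
  by rewrite [RHS]alt_sum_map.
by move=> u v ws; rewrite Dsym.
Qed.

End Pullback.

(** * The Hodge star *)

Section BasisLists.
Context {R : realType} {n : nat}.
Local Notation V := 'rV[R]_n.
Implicit Types (w : @multicovector R n) (s t r vs : seq V) (a b c : seq 'I_n).

Lemma alternating_catr w r : is_alternating w ->
  is_alternating (fun vs => w (vs ++ r)).
Proof.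
move=> aw; split=> [s t a u v|s t q u].
  by rewrite -!catA /= (proj1 aw).
by rewrite -!catA /= -catA /= (proj2 aw).
Qed.

Lemma alternating_scale_size w (f : nat -> R) : is_alternating w ->
  is_alternating (fun vs => f (size vs) * w vs).
Proof.
move=> aw; split=> [s t a u v|s t q u]; last by rewrite (proj2 aw) mulr0.
by rewrite !size_cat /= (proj1 aw) mulrDr mulrCA.
Qed.

(** The sign is chosen before [w], so two different alternating functions change by the same sign;
    [hodge_contraction] relies on this. *)
Lemma alternating_perm s t : perm_eq s t ->
  exists e : bool, forall w, is_alternating w -> w s = (-1) ^+ e * w t.
Proof.
elim: s t => [|u s IH] t st.
  by move: st; rewrite perm_sym => /perm_nilP ->; exists false => w _; rewrite mul1r.
have ut : u \in t by rewrite -(perm_mem st) mem_head.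
case/splitPr: ut st => t1 t2; rewrite perm_sym perm_catC /= perm_cons => st.
have {}st : perm_eq s (t1 ++ t2) by rewrite perm_sym perm_catC.
have [e eP] := IH _ st.
exists (e (+) odd (size t1)) => w aw.
rewrite (eP _ (alternating_cons u aw)) (@alternating_move _ _ _ [::])//.
by rewrite signr_addb signr_odd mulrA.
Qed.

Lemma alternating_catC w s t : is_alternating w ->
  w (s ++ t) = (-1) ^+ (size s * size t) * w (t ++ s).
Proof.
move=> aw; elim: s t => [|u s IH] t; first by rewrite /= cats0 mul1r.
rewrite /= -[s ++ t]cats0 (@alternating_move _ _ _ [::])//= -catA IH.
rewrite -catA /= mulrA -exprD !size_cat /=; congr (_ * _).
rewrite -signr_odd -[RHS]signr_odd addn1 !(oddD, oddM) /=.
by case: (odd (size s)); case: (odd (size t)).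
Qed.

Lemma alternating_nuniq w c : is_alternating w -> ~~ uniq c ->
  w [seq frame_vec i | i <- c] = 0.
Proof.
elim: c w => [//|i c IH] w aw /=; rewrite negb_and negbK.
have [ic _|_ /= nc] := boolP (i \in c); last by rewrite (IH _ (alternating_cons _ aw)).
by case/splitPr: ic => c1 c2; rewrite map_cat /= (proj2 aw [::]).
Qed.

Lemma eq_alternating w w' : is_alternating w -> is_alternating w' ->
  (forall c, w [seq frame_vec i | i <- c] = w' [seq frame_vec i | i <- c]) ->
  w =1 w'.
Proof.
(* The induction carries a prefix of frame vectors: the first remaining vector is expanded in the
   basis and each resulting frame vector joins the prefix. *)
move=> aw aw' ww' vs.
suff H c : w ([seq frame_vec i | i <- c] ++ vs) = w' ([seq frame_vec i | i <- c] ++ vs).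
  exact: (H [::]).
elim: vs c => [|v vs IH] c; first by rewrite !cats0.
rewrite (row_frame_sum v) !alternating_sum//.
by apply: eq_bigr => i _; have := IH (rcons c i); rewrite map_rcons !cat_rcons => ->.
Qed.

Lemma perm_enum_ord c : uniq c -> size c = n -> perm_eq c (enum 'I_n).
Proof.
move=> uc szc; apply: uniq_perm; rewrite ?enum_uniq// => i.
have [|_ -> //] := uniq_min_size uc (fun j _ => mem_enum 'I_n j).
by rewrite szc size_enum_ord.
Qed.

(** By pigeonhole a list of more than [n] frame vectors repeats one. The factor [(n < size vs)%:R]
    cuts off the low degrees, so that [eq_alternating] can compare with zero. *)
Lemma alternating_gt w vs : is_alternating w -> (n < size vs)%N -> w vs = 0.
Proof.
move=> aw nvs.
have a0 : is_alternating (fun vs => (n < size vs)%:R * w vs).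
  exact: (alternating_scale_size (fun m => (n < m)%:R)).
have a0' : is_alternating (fun _ : seq V => 0 : R).
  by split=> [*|//]; rewrite mulr0 addr0.
have := eq_alternating a0 a0' _ vs; rewrite nvs mul1r; apply => c.
rewrite size_map; case: ltnP => [nc|]; last by rewrite mul0r.
rewrite mul1r alternating_nuniq//; apply/negP => uc.
have := uniq_leq_size uc (fun i _ => mem_enum 'I_n i).
by rewrite size_enum_ord leqNgt nc.
Qed.

Lemma big_tuple_cons (T : finType) k (F : seq T -> R) :
  \sum_(t : k.+1.-tuple T) F t = \sum_i \sum_(t : k.-tuple T) F (i :: t).
Proof.
rewrite pair_big /=.
rewrite (reindex (fun p : T * k.-tuple T => cons_tuple p.1 p.2))//.
exists (fun t : k.+1.-tuple T => (thead t, behead_tuple t)).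
  by move=> [i t] _; congr pair; apply: val_inj.
by move=> t _; rewrite [RHS]tuple_eta; exact: val_inj.
Qed.

(** With [M] the inverse metric, this absorbs the products in [hodge_star]: raising indices amounts
    to passing rows of [invmx G] as arguments. *)
Lemma alternating_expand w (M : 'M[R]_n) k (a : k.-tuple 'I_n) : is_alternating w ->
  \sum_(b : k.-tuple 'I_n) (\prod_(l < k) M (tnth a l) (tnth b l)) *
    w [seq frame_vec i | i <- b] = w [seq row i M | i <- a].
Proof.
pose p (a b : seq 'I_n) : R := \prod_(ij <- zip a b) M ij.1 ij.2.
have pE m (a' b' : m.-tuple 'I_n) :
    \prod_(l < m) M (tnth a' l) (tnth b' l) = p a' b'.
  elim: m a' b' => [|m IH] a' b'.
    by rewrite (tuple0 a') (tuple0 b') big_ord0 /p big_nil.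
  case/tupleP: a' => i a'; case/tupleP: b' => j b'.
  rewrite big_ord_recl !tnth0; under eq_bigr do rewrite !tnthS.
  by rewrite IH /p /= big_cons.
under eq_bigr do rewrite pE.
elim: k w a => [|k IH] w a aw.
  rewrite (big_pred1 [tuple]) => [|b /=]; last first.
    exact/esym/eqP/val_inj/size0nil/size_tuple.
  by rewrite (tuple0 a) /p big_nil mul1r.
case/tupleP: a => i a /=.
rewrite (@big_tuple_cons _ _ (fun b => p (i :: a) b * w [seq frame_vec i | i <- b])).
rewrite (row_frame_sum (row i M)) (@alternating_sum _ _ _ [::])//.
apply: eq_bigr => j _; rewrite mxE -(IH _ a (alternating_cons _ aw)) mulr_sumr.
by apply: eq_bigr => b _; rewrite {1}/p /= big_cons -mulrA.
Qed.

Lemma card_tuple_perm k c : uniq c -> size c = k ->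
  #|[pred b : k.-tuple 'I_n | perm_eq b c]| = k`!.
Proof.
move=> uc szc; rewrite -szc -size_permutations// cardE -(size_map val).
apply/perm_size/uniq_perm; rewrite ?permutations_uniq//.
  by rewrite map_inj_uniq ?enum_uniq//; exact: val_inj.
move=> b; rewrite mem_permutations; apply/mapP/idP => [[t]|bc].
  by rewrite mem_enum inE => tc ->.
have szb : size b == size c by rewrite (perm_size bc).
by exists (Tuple szb); rewrite // mem_enum inE.
Qed.

End BasisLists.

(** * The star through determinants, its square and its inverse *)

Section HodgeStar.
Context {R : realType} {n : nat}.
Local Notation V := 'rV[R]_n.
Implicit Types (w : @multicovector R n) (s t r vs : seq V) (a b c : seq 'I_n).

Definition seq_det vs : R :=
  if size vs == n then \det (\matrix_(a < n) nth 0 vs a) else 0.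

Lemma seq_det_alternating : is_alternating seq_det.
Proof.
split=> [s t a u v|s t r u]; rewrite /seq_det.
- rewrite !size_cat /=; case: eqP => [szn|]; last by rewrite mulr0 addr0.
  have sn : (size s < n)%N.
    by apply: leq_trans (eq_leq szn); rewrite addnS ltnS leq_addr.
  pose i0 := Ordinal sn.
  have off i x y : nth 0 (s ++ x :: t) (lift i0 i) = nth 0 (s ++ y :: t) (lift i0 i).
    rewrite !nth_cat; case: ltnP => // si.
    have : (size s != lift i0 i)%N by exact: neq_bump.
    move: (lift i0 i) si => k; rewrite leq_eqVlt -subn_gt0.
    by move=> /orP[->//|]; case: (k - _)%N.
  rewrite -[X in _ = _ + X]mul1r; apply: (determinant_multilinear (i0 := i0)).
  + by apply/rowP => j; rewrite !mxE !nth_cat /= !ltnn !subnn /= !mxE mul1r.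
  + by apply/matrixP => i j; rewrite !mxE (off _ u (a *: u + v)).
  + by apply/matrixP => i j; rewrite !mxE (off _ v (a *: u + v)).
- rewrite !size_cat /= !size_cat /=; case: eqP => // szn.
  have i1n : (size s < n)%N.
    by apply: leq_trans (eq_leq szn); rewrite addnS ltnS leq_addr.
  have i2n : (size s + (size t).+1 < n)%N.
    apply: leq_trans (eq_leq szn).
    by rewrite -addnS leq_add2l !ltnS addnS ltnS leq_addr.
  apply: (@determinant_alternate _ _ _ (Ordinal i1n) (Ordinal i2n)).
    by rewrite -val_eqE /= -[X in X == _]addn0 eqn_add2l.
  move=> j; rewrite !mxE !nth_cat ltnn subnn /= -[X in (_ < X)%N]addn0 ltn_add2l /=.
  by rewrite addKn /= nth_cat ltnn subnn.
Qed.

Lemma seq_det_map (M : 'M[R]_n) vs :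
  seq_det [seq v *m M | v <- vs] = seq_det vs * \det M.
Proof.
rewrite /seq_det size_map; case: eqP => [szn|]; last by rewrite mul0r.
rewrite -det_mulmx; congr (\det _); apply/row_matrixP => i.
by rewrite row_mul !rowK (nth_map 0)// szn.
Qed.

Lemma seq_det_enum : seq_det [seq frame_vec i | i <- enum 'I_n] = 1.
Proof.
rewrite /seq_det size_map size_enum_ord eqxx.
rewrite [X in \det X](_ : _ = 1%:M) ?det1//.
apply/row_matrixP => i; rewrite rowK (nth_map i) ?size_enum_ord// nth_ord_enum.
by rewrite row1.
Qed.

Lemma seq_det_sqr c : uniq c -> size c = n ->
  seq_det [seq frame_vec i | i <- c] * seq_det [seq frame_vec i | i <- c] = 1.
Proof.
move=> uc szc.
have pc : perm_eq [seq @frame_vec R n i | i <- c] [seq frame_vec i | i <- enum 'I_n].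
  by apply: perm_map; exact: perm_enum_ord.
have [e eP] := alternating_perm pc.
by rewrite !eP ?seq_det_enum ?mulr1 -?signr_addb ?addbb//; exact: seq_det_alternating.
Qed.

Lemma volume_formE (G : 'M[R]_n) (s : R) vs :
  volume_form G s vs = s * Num.sqrt (\det G) * seq_det vs.
Proof. by rewrite /volume_form /seq_det; case: eqP => // _; rewrite mulr0. Qed.

Lemma hodge_starE (G : 'M[R]_n) (s : R) w vs : hodge_star G s w vs =
  s * Num.sqrt (\det G) * ((n - size vs)`!%:R)^-1 *
  \sum_(a : (n - size vs).-tuple 'I_n) w [seq frame_vec i | i <- a] *
     seq_det ([seq row i (invmx G) | i <- a] ++ vs).
Proof.
rewrite /hodge_star -[RHS]mulrA [RHS]mulrCA; congr (_ * _).
rewrite mulr_sumr; apply: eq_bigr => a _.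
rewrite -(alternating_expand _ _ (alternating_catr vs seq_det_alternating)).
rewrite !mulr_sumr; apply: eq_bigr => b _.
by rewrite volume_formE; ring.
Qed.

(** Symmetry of [G] lets the arguments of [w] be raised instead of those of the determinant. In
    [hodge_starK] the outer star takes this form and the inner one that of [hodge_starE], so all
    rows of [invmx G] meet in a single determinant and contribute [\det (invmx G)]. *)
Lemma hodge_starE_sym (G : 'M[R]_n) (s : R) w vs : G^T = G -> is_alternating w ->
  hodge_star G s w vs =
  s * Num.sqrt (\det G) * ((n - size vs)`!%:R)^-1 *
  \sum_(b : (n - size vs).-tuple 'I_n) w [seq row i (invmx G) | i <- b] *
     seq_det ([seq frame_vec i | i <- b] ++ vs).
Proof.
move=> Gs aw; rewrite /hodge_star -[RHS]mulrA [RHS]mulrCA; congr (_ * _).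
rewrite exchange_big mulr_sumr; apply: eq_bigr => b _ /=.
rewrite -(alternating_expand _ _ aw) mulr_suml mulr_sumr; apply: eq_bigr => a _.
have -> : \prod_(l < n - size vs) invmx G (tnth a l) (tnth b l) =
    \prod_(l < n - size vs) invmx G (tnth b l) (tnth a l).
  by apply: eq_bigr => l _; rewrite -[in LHS]Gs -trmx_inv mxE.
by rewrite volume_formE; ring.
Qed.

(** The arguments enter only through [seq_det], from which alternation is inherited. *)
Lemma hodge_star_alternating (G : 'M[R]_n) (s : R) w :
  is_alternating (hodge_star G s w).
Proof.
split=> [t r a u v|t r q u]; rewrite !hodge_starE.
- rewrite !size_cat /= mulrCA -mulrDr; congr (_ * _).
  rewrite mulr_sumr -big_split /=; apply: eq_bigr => b _.
  by rewrite !catA (proj1 seq_det_alternating) mulrDr mulrCA.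
- rewrite big1 ?mulr0// => b _.
  by rewrite catA (proj2 seq_det_alternating) mulr0.
Qed.

Lemma hodge_star_gt (G : 'M[R]_n) (s : R) w vs : (n < size vs)%N ->
  hodge_star G s w vs = 0.
Proof. by apply: alternating_gt; exact: hodge_star_alternating. Qed.

Lemma hodge_star_scale_size (G : 'M[R]_n) (s : R) w (f : nat -> R) vs :
  hodge_star G s (fun us => f (size us) * w us) vs =
  f (n - size vs)%N * hodge_star G s w vs.
Proof.
rewrite !hodge_starE [RHS]mulrCA; congr (_ * _); rewrite mulr_sumr.
by apply: eq_bigr => a _; rewrite size_map size_tuple mulrA.
Qed.

(* The only nonzero terms have [a] a permutation of [c] and [b] a permutation of
   its complement; they are all equal, [w] and [seq_det] changing sign together
   with [a]. *)
Lemma hodge_contraction w c : is_alternating w -> uniq c -> (size c <= n)%N ->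
  \sum_(b : (n - size c).-tuple 'I_n) \sum_(a : (size c).-tuple 'I_n)
    w [seq frame_vec i | i <- a] *
    seq_det ([seq frame_vec i | i <- a] ++ [seq frame_vec i | i <- b]) *
    seq_det ([seq frame_vec i | i <- b] ++ [seq frame_vec i | i <- c]) =
  (-1) ^+ (size c * (n - size c)) * ((size c)`! * (n - size c)`!)%:R *
    w [seq frame_vec i | i <- c].
Proof.
move=> aw uc szc; pose c' := [seq i <- enum 'I_n | i \notin c].
have enumc : perm_eq (c' ++ c) (enum 'I_n).
  have pf : perm_eq ([seq i <- enum 'I_n | i \in c] ++ c') (enum 'I_n).
    by apply/permPl; exact: perm_filterC.
  apply: perm_trans pf; rewrite perm_catC perm_cat2r; apply: uniq_perm => //.
    by rewrite filter_uniq// enum_uniq.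
  by move=> i; rewrite mem_filter mem_enum andbT.
have szc' : size c' = (n - size c)%N.
  by rewrite -[LHS](addnK (size c)) -size_cat (perm_size enumc) size_enum_ord.
have uc' : uniq c' by rewrite filter_uniq// enum_uniq.
transitivity (\sum_(b : (n - size c).-tuple 'I_n | perm_eq b c')
    \sum_(a : (size c).-tuple 'I_n | perm_eq a c)
      (-1) ^+ (size c * (n - size c)) * w [seq frame_vec i | i <- c]); last first.
  rewrite !sumr_const.
  have -> : #|[pred b : (n - size c).-tuple 'I_n | perm_eq b c']| = (n - size c)`!.
    exact: card_tuple_perm.
  have -> : #|[pred a : (size c).-tuple 'I_n | perm_eq a c]| = (size c)`!.
    exact: card_tuple_perm.
  by rewrite -mulrnA -[LHS]mulr_natr mulrAC.
rewrite [RHS]big_mkcond; apply: eq_bigr => b _.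
have [bc|bc] := boolP (perm_eq b c'); last first.
  apply: big1 => a _; rewrite -!map_cat [X in _ * X]alternating_nuniq ?mulr0//.
    exact: seq_det_alternating.
  apply: contra bc => ubc.
  have /perm_enum_ord/(_ _) := ubc.
  rewrite size_cat size_tuple subnK// => /(_ erefl) bce.
  by rewrite -(perm_cat2r c) (permPl bce) perm_sym.
have bce : perm_eq (b ++ c) (enum 'I_n).
  by apply: perm_trans enumc; rewrite perm_cat2r.
have cbe : perm_eq (c ++ b) (enum 'I_n) by rewrite perm_catC.
rewrite [RHS]big_mkcond; apply: eq_bigr => a _.
have [ac|ac] := boolP (perm_eq a c); last first.
  rewrite -!map_cat [X in _ * X * _]alternating_nuniq ?mulr0 ?mul0r//.
    exact: seq_det_alternating.
  apply: contra ac => uab.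
  have /perm_enum_ord/(_ _) := uab.
  rewrite size_cat !size_tuple subnKC// => /(_ erefl) abe.
  by rewrite -(perm_cat2r b) (permPl abe) perm_sym.
have [e eP] := alternating_perm (perm_map (@frame_vec R n) ac).
rewrite (eP _ aw) (eP _ (alternating_catr _ seq_det_alternating)).
rewrite [X in _ * X](alternating_catC _ _ seq_det_alternating) !size_map size_tuple.
rewrite [((n - size c) * size c)%N]mulnC -!map_cat.
(* Up to sign both determinants are now the same [D], taken on a permutation of the frame, so
   [D * D = 1]; the sign of reordering [a] also occurs twice. *)
have := @seq_det_sqr (c ++ b); rewrite (perm_uniq cbe) enum_uniq (perm_size cbe).
rewrite size_enum_ord => /(_ isT erefl); set D := seq_det _ => DD.
have : (-1) ^+ e * (-1) ^+ e = 1 :> R by rewrite -signr_addb addbb.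
set x := (-1) ^+ e; set y := (-1) ^+ _ => xx.
have -> : x * w [seq frame_vec i | i <- c] * (x * D) * (y * D) =
  (x * x) * (D * D) * (y * w [seq frame_vec i | i <- c]) by ring.
by rewrite xx DD !mul1r.
Qed.

Lemma hodge_starK (G : 'M[R]_n) (s : R) w vs : G^T = G -> 0 < \det G -> s * s = 1 ->
  is_alternating w ->
  hodge_star G s (hodge_star G s w) vs = (-1) ^+ (size vs * (n - size vs)) * w vs.
Proof.
move=> Gs G0 ss aw; move: vs.
apply: eq_alternating; first exact: hodge_star_alternating.
  exact: (alternating_scale_size (fun m => (-1) ^+ (m * (n - m)))).
move=> c.
have [uc|nuc] := boolP (uniq c); last first.
  by rewrite !alternating_nuniq ?mulr0//; exact: hodge_star_alternating.
have szc : (size c <= n)%N.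
  by have := uniq_leq_size uc (fun i _ => mem_enum 'I_n i); rewrite size_enum_ord.
rewrite hodge_starE_sym//; last exact: hodge_star_alternating.
rewrite size_map.
under eq_bigr => b _.
  rewrite hodge_starE size_map size_tuple subKn//.
  rewrite (eq_bigr (fun a : (size c).-tuple 'I_n => \det (invmx G) *
     (w [seq frame_vec i | i <- a] *
      seq_det ([seq frame_vec i | i <- a] ++ [seq frame_vec i | i <- b])))); last first.
    move=> a _; rewrite -!map_cat [X in _ * X](_ : _ =
        seq_det [seq v *m invmx G | v <- [seq frame_vec i | i <- a ++ b]]).
      by rewrite seq_det_map mulrA mulrC.
    by rewrite -map_comp; congr seq_det; apply: eq_map => i; rewrite /= rowE.
  rewrite -mulr_sumr mulrA -mulrA mulr_suml.
  over.
rewrite -mulr_sumr hodge_contraction// det_inv.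
have sq : Num.sqrt (\det G) * Num.sqrt (\det G) = \det G.
  by rewrite -expr2 sqr_sqrtr// ltW.
have D0 : \det G != 0 by rewrite gt_eqF.
have f1 : ((n - size c)`!%:R : R) != 0 by rewrite pnatr_eq0 -lt0n fact_gt0.
have f2 : ((size c)`!%:R : R) != 0 by rewrite pnatr_eq0 -lt0n fact_gt0.
rewrite natrM.
move: sq ss D0 f1 f2.
set x := Num.sqrt _; set f := _%:R; set h := _%:R; set D := \det G.
set e := (-1) ^+ _; set W := w _ => sq ss D0 f1 f2.
have -> : s * x / f * (s * x / h / D * (e * (h * f) * W)) =
  (s * s) * (x * x) / D * (f / f) * (h / h) * (e * W) by ring.
by rewrite ss sq mul1r !divff// !mul1r.
Qed.

Lemma hodge_star_invK (G : 'M[R]_n) (s : R) w : G^T = G -> 0 < \det G -> s * s = 1 ->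
  is_alternating w ->
  is_alternating (hodge_star_inv G s w) /\
  hodge_star G s (hodge_star_inv G s w) = w.
Proof.
move=> Gs G0 ss aw.
apply: (@getPex _ [set w' | is_alternating w' /\ hodge_star G s w' = w]).
(* The exponent [m (n - m)] is unchanged by [m -> n - m], so this sign cancels the one from
   [hodge_starK]. *)
exists (fun vs => (-1) ^+ (size vs * (n - size vs)) * hodge_star G s w vs); split.
  apply: (alternating_scale_size (fun m => (-1) ^+ (m * (n - m)))).
  exact: hodge_star_alternating.
apply/funext => vs.
(* Above degree [n] the identity [n - (n - m) = m] fails for truncated subtraction, but there both
   sides vanish. *)
have [nvs|vsn] := ltnP n (size vs).
  by rewrite hodge_star_gt// alternating_gt.
rewrite (hodge_star_scale_size _ _ _ (fun m => (-1) ^+ (m * (n - m)))).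
rewrite hodge_starK// subKn// (mulnC (n - size vs)%N) mulrA -exprD addnn -mul2n exprM.
by rewrite sqrrN !expr1n mul1r.
Qed.

(** The choice could a priori return any alternating preimage of zero; applying the star once more
    shows that such a preimage is zero up to sign. *)
Lemma hodge_star_inv0 (G : 'M[R]_n) (s : R) : G^T = G -> 0 < \det G -> s * s = 1 ->
  hodge_star_inv G s (fun=> 0) = (fun=> 0).
Proof.
move=> Gs G0 ss.
have a0 : is_alternating (fun _ : seq V => 0 : R).
  by split=> [*|//]; rewrite mulr0 addr0.
have [aw E] := hodge_star_invK Gs G0 ss a0.
apply/funext => vs; have := hodge_starK vs Gs G0 ss aw.
rewrite E hodge_starE big1 => [|b _]; last by rewrite mul0r.
by rewrite mulr0 => /esym/eqP; rewrite mulf_eq0 signr_eq0 => /eqP.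
Qed.

End HodgeStar.

Lemma det_posdef_gt0 (R : realType) n (G : 'M[R]_n) :
  (forall v : 'rV[R]_n, v != 0 -> 0 < (v *m G *m v^T) ord0 ord0) -> 0 < \det G.
Proof.
move=> Gpos; rewrite ltNge; apply/negP => G0.
(* [p] is monic, has no root on the nonnegative half-line, and [p.[0] = \det G]. *)
pose p := char_poly (- G).
have p0 : p.[0] = \det G.
  rewrite horner_coef0 char_poly_det -[- G]scaleN1r detZ mulrA -exprD addnn.
  by rewrite -mul2n exprM sqrrN !expr1n mul1r.
have [|N Np] := @polyrcf.poly_pinfty_gt_lc R p.
  by rewrite (monicP (char_poly_monic _)).
have [||x /andP[x0 _] px] := @poly_ivt R p 0 (Num.max N 0).
- by rewrite le_max lexx orbT.
- rewrite p0 G0 /=; apply: le_trans (Np _ _); last by rewrite le_max lexx.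
  by rewrite (monicP (char_poly_monic _)).
(* An eigenvector of [- G] for [x >= 0] gives [v G v^T = - x |v|^2 <= 0], against positivity. *)
have /eigenvalueP[v vG v0] : eigenvalue (- G) x by rewrite eigenvalue_root_char.
have := Gpos v v0; rewrite -[G]opprK mulmxN vG mulNmx -scalemxAl !mxE ltNge.
rewrite oppr_le0 mulr_ge0// sumr_ge0// => j _.
by rewrite !mxE -expr2 sqr_ge0.
Qed.

(** * Forms on a manifold *)

Section Charts.
Context {R : realType} {n : nat} {M : smooth_manifold R n}.
Implicit Types (U : set M) (i j : chart M) (p : M).

Lemma coord_image_coordV U i x : (coord i @` (U `&` dom i)) x ->
  (U `&` dom i) (coordV i x) /\ coord i (coordV i x) = x.
Proof. by move=> [p [Up ip] <-]; rewrite coordK. Qed.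

(** Local expressions of fields agree only on such images, and derivatives can be compared there
    because the images are open. *)
Lemma coord_image_open U i : open U -> open (coord i @` (U `&` dom i)).
Proof.
move=> oU; rewrite openE => x [p [Up ip] <-].
have cV : {for coord i p, continuous (coordV i)}.
  by apply: chartV_continuous; rewrite inE; exists p.
have nU : nbhs (coordV i (coord i p)) U.
  by rewrite coordK//; exact: open_nbhs_nbhs.
have nV : \forall y \near coord i p, U (coordV i y) by exact: cV nU.
have nR : \forall y \near coord i p, (coord i @` dom i) y.
  by apply: open_nbhs_nbhs; split; [exact: range_open|exists p].
apply: filterS2 nV nR => y Uy [q iq qy]; exists q => //; split=> //.
by move: Uy; rewrite -qy coordK.
Qed.

Definition smooth_field U (omega : field M) : Prop := forall i vs,
  smooth_on (coord i @` (U `&` dom i)) (fun x => omega i (coordV i x) vs : R^o).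

Definition alternating_field U (omega : field M) : Prop := forall i p,
  (U `&` dom i) p -> is_alternating (omega i p).

Definition localize (omega : field M) i x vs := omega i (coordV i x) vs.

Lemma ext_d_localE (omega : field M) i p vs :
  ext_d omega i p vs = local_d (localize omega i) (coord i p) vs.
Proof. by []. Qed.

Variable U : set M.
Hypothesis oU : open U.

Lemma ext_d_ext (omega theta : field M) :
  eq_on U omega theta -> eq_on U (ext_d omega) (ext_d theta).
Proof.
move=> E i p Uip vs; rewrite !ext_d_localE.
apply: (local_d_ext vs (coord_image_open (i := i) oU)); first by exists p.
by move=> y /coord_image_coordV[Uy _] ws; exact: E.
Qed.

Lemma ext_d_smooth (omega : field M) :
  smooth_field U omega -> smooth_field U (ext_d omega).
Proof.
move=> som i vs.
apply: (@smooth_on_ext _ _ _ _ (fun x => local_d (localize omega i) x vs : R^o)).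
- exact: coord_image_open.
- by move=> x /coord_image_coordV[_ xE]; rewrite ext_d_localE xE.
- apply: local_d_smooth; first exact: coord_image_open.
  by move=> ws; exact: som.
Qed.

Lemma ext_d_ext_d (omega : field M) : smooth_field U omega ->
  eq_on U (ext_d (ext_d omega)) field0.
Proof.
move=> som i p Uip vs; have oA := coord_image_open (i := i) oU.
have Ap : (coord i @` (U `&` dom i)) (coord i p) by exists p.
rewrite ext_d_localE -[RHS](local_d_local_d vs oA Ap (som i)).
apply: (local_d_ext vs oA Ap) => y /coord_image_coordV[_ yE] ws.
by rewrite /localize ext_d_localE yE.
Qed.

Lemma ext_d_alternating (omega : field M) :
  smooth_field U omega -> alternating_field U omega ->
  alternating_field U (ext_d omega).
Proof.
move=> som aom i p Uip; have oA := coord_image_open (i := i) oU.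
have Ap : (coord i @` (U `&` dom i)) (coord i p) by exists p.
apply: (local_d_alternating (F := localize omega i) oA Ap).
  by move=> y /coord_image_coordV[Uy _]; exact: aom.
by move=> ws; exact: smooth_on_diff (som i ws) Ap.
Qed.

(** On the overlap, the expression of [omega] in chart [i] is the pullback of that in chart [j] by
    the transition map, its Jacobian acting as a directional derivative; [local_d_pullback] then
    applies. *)
Lemma ext_d_transition (omega : field M) i j p vs :
  smooth_field U omega -> alternating_field U omega ->
  (forall i j p, (U `&` dom i `&` dom j) p -> forall vs,
     omega i p vs = omega j p [seq v *m transition_jac i j p | v <- vs]) ->
  (U `&` dom i `&` dom j) p ->
  ext_d omega i p vs = ext_d omega j p [seq v *m transition_jac i j p | v <- vs].
Proof.
move=> som aom tom [[Up ip] jp]; pose phi := coord j \o coordV i.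
pose A := coord i @` ((U `&` dom j) `&` dom i).
pose B := coord j @` (U `&` dom j).
have oA : open A by apply: coord_image_open; apply: openI => //; exact: dom_open.
have oB : open B by exact: coord_image_open.
have Ap : A (coord i p) by exists p.
have sphi : smooth_on A phi.
  by move=> us x [q [[Uq jq] iq] <-]; apply: (transition_smooth (i := i)); exists q.
have jac y v : A y -> v *m transition_jac i j (coordV i y) = 'D_v phi y.
  move=> Ay; rewrite (deriveEjacobian _ (smooth_on_diff sphi Ay)).
  by have [_ yE] := coord_image_coordV Ay; rewrite /transition_jac yE.
rewrite !ext_d_localE.
have phiE : phi (coord i p) = coord j p by rewrite /phi /= coordK.
have -> : [seq v *m transition_jac i j p | v <- vs] =
    [seq 'D_v phi (coord i p) | v <- vs].
  by apply: eq_map => v; have := jac _ v Ap; rewrite coordK.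
rewrite -phiE -(local_d_pullback oA oB Ap _ _ vs sphi).
- apply: (local_d_ext vs oA Ap) => y Ay ws.
  have [[[Uy jy] iy] yE] := coord_image_coordV Ay.
  rewrite /localize (tom i j)// /phi /= coordK//; congr (omega j _ _).
  by apply: eq_map => v; exact: jac.
- by move=> y [q [[Uq jq] iq] <-]; rewrite /phi /= coordK//; exists q.
- exact: smooth_on_diff Ap.
- by move=> z /coord_image_coordV[Uz _]; exact: aom.
- exact: som.
Qed.

Lemma Lambda_smooth k (omega : field M) : Lambda U k omega -> smooth_field U omega.
Proof. by case. Qed.

Lemma Lambda_alternating k (omega : field M) :
  Lambda U k omega -> alternating_field U omega.
Proof. by case=> ao _ _ i p /ao[]. Qed.

Lemma ext_d_Lambda k (omega : field M) :
  Lambda U k omega -> Lambda U k.+1 (ext_d omega).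
Proof.
move=> Lom; have som := Lambda_smooth Lom; have aom := Lambda_alternating Lom.
have [hom _ tom] := Lom; split.
- move=> i p Uip; split; first exact: ext_d_alternating.
  have oA := coord_image_open (i := i) oU.
  have Ap : (coord i @` (U `&` dom i)) (coord i p) by exists p.
  apply: (local_d_homogeneous (F := localize omega i) oA Ap).
  by move=> y /coord_image_coordV[Uy _]; exact: (proj2 (hom i _ Uy)).
- exact: ext_d_smooth.
- by move=> i j p Uijp vs; exact: ext_d_transition.
Qed.

Lemma Lambda_ext k (omega theta : field M) :
  eq_on U omega theta -> Lambda U k omega -> Lambda U k theta.
Proof.
move=> E [hom som tom]; split.
- move=> i p Uip; have -> : theta i p = omega i p by apply/funext => vs; rewrite E.
  exact: hom.
- move=> i vs; apply: smooth_on_ext (som i vs); first exact: coord_image_open.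
  by move=> x /coord_image_coordV[Ux _]; exact: E.
- move=> i j p Uijp vs; have [[Up ip] jp] := Uijp.
  by rewrite -!E//; exact: tom.
Qed.

(** [d] hands [omega] lists one vector shorter, whence the predecessor; on the empty list both sides
    are zero. *)
Lemma ext_d_scale_size (omega : field M) (f : nat -> R) : smooth_field U omega ->
  eq_on U (ext_d (fun i p vs => f (size vs) * omega i p vs))
    (fun i p vs => f (size vs).-1 * ext_d omega i p vs).
Proof.
move=> som i p Uip vs; have oA := coord_image_open (i := i) oU.
have Ap : (coord i @` (U `&` dom i)) (coord i p) by exists p.
rewrite !ext_d_localE /local_d /alt_sum mulr_sumr; apply: eq_bigr => l _.
rewrite mulrCA; congr (_ * _).
have d0 : differentiable (fun _ : 'rV[R]_n => 0 : R^o) (coord i p).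
  exact: differentiable_cst.
rewrite (derive_lin (f1 := fun y => localize omega i y (take l vs ++ drop l.+1 vs))
  (f2 := fun=> 0) (a := f (size vs).-1) _ oA Ap (smooth_on_diff (som _ _) Ap) d0).
  by rewrite [X in _ + X](@derive_cst _ _ R^o) addr0.
move=> y _; rewrite addr0 /localize; congr (f _ * _).
rewrite size_cat size_take size_drop ltn_ord subnS.
rewrite -[RHS](congr1 predn (subnKC (ltnW (ltn_ord l)))).
by rewrite -[in RHS](prednK (n := size vs - l)) ?subn_gt0// addnS.
Qed.

(** * Star and codifferential of a metric and an orientation *)

Variables (g : chart M -> M -> 'M[R]_n) (o : chart M -> M -> R).
Hypotheses (g_metric : riemannian_metric U g) (o_orientation : orientation U o).

Lemma metric_det_gt0 i p : (U `&` dom i) p -> 0 < \det (g i p).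
Proof. by case: g_metric => _ gpos _ _ Uip; apply: det_posdef_gt0; exact: gpos. Qed.

Lemma metric_sym i p : (U `&` dom i) p -> (g i p)^T = g i p.
Proof. by case: g_metric => + _ _ _; apply. Qed.

Lemma orientation_sqr i p : (U `&` dom i) p -> o i p * o i p = 1.
Proof.
by case: o_orientation => ho _ _ /ho[] ->; rewrite ?mulr1// mulrNN mulr1.
Qed.

Lemma orientation_smooth i :
  smooth_on (coord i @` (U `&` dom i)) (fun x => o i (coordV i x) : R^o).
Proof.
have [ho co _] := o_orientation; have oA := coord_image_open (i := i) oU.
apply: smooth_on_locally_cst => // x Ax.
have [[Ux ix] xE] := coord_image_coordV Ax.
have cV : coordV i y @[y --> x] --> coordV i x.
  rewrite -{1}xE -{2}xE; apply: chartV_continuous.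
  by rewrite inE; exists (coordV i x).
have cO : o i q @[q --> coordV i x] --> o i (coordV i x).
  by apply: co; rewrite inE.
have cOV : o i (coordV i y) @[y --> x] --> o i (coordV i x).
  exact: cvg_comp cV cO.
(* Distinct values of the sign lie at distance [2], so a distance below [1] forces equality. *)
have n1 : \forall y \near x, `|o i (coordV i x) - o i (coordV i y)| < 1.
  exact: (cvgrPdist_lt _ _).1 cOV 1 ltr01.
have nA : \forall y \near x, (coord i @` (U `&` dom i)) y by exact: open_nbhs_nbhs.
apply: filterS2 n1 nA => y /= lt1 /coord_image_coordV[Uy _].
have two_ge1 : (1 <= 1 + 1 :> R) by rewrite lerDl.
move: lt1; case: (ho i _ Uy) => ->; case: (ho i _ (conj Ux ix)) => -> //.
- by rewrite -opprD normrN ger0_norm ?addr_ge0// ltNge two_ge1.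
- by rewrite opprK ger0_norm ?addr_ge0// ltNge two_ge1.
Qed.

Lemma eta_smooth (omega : field M) : smooth_field U omega -> smooth_field U (eta omega).
Proof.
move=> som i vs; apply: smooth_onM (som i vs); first exact: coord_image_open.
exact: smooth_on_cst.
Qed.

Lemma star_smooth (omega : field M) :
  smooth_field U omega -> smooth_field U (star g o omega).
Proof.
move=> som i vs; have oA := coord_image_open (i := i) oU.
have sg : forall a b, smooth_on (coord i @` (U `&` dom i))
    (fun x => g i (coordV i x) a b : R^o) by case: g_metric.
have det0 x : (coord i @` (U `&` dom i)) x -> 0 < \det (g i (coordV i x)).
  by move=> /coord_image_coordV[Ux _]; exact: metric_det_gt0.
(* The star with [volume_form] split into a smooth factor and a determinant that is constant in
   [x]. *)
pose f (x : 'rV[R]_n) : R := ((n - size vs)`!%:R)^-1 *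
  \sum_(a : (n - size vs).-tuple 'I_n) \sum_(b : (n - size vs).-tuple 'I_n)
    (\prod_(l < (n - size vs)) invmx (g i (coordV i x)) (tnth a l) (tnth b l)) *
    omega i (coordV i x) [seq frame_vec c | c <- a] *
    (o i (coordV i x) * Num.sqrt (\det (g i (coordV i x))) *
     seq_det ([seq frame_vec c | c <- b] ++ vs)).
suff sf : smooth_on (coord i @` (U `&` dom i)) (f : 'rV[R]_n -> R^o).
  apply: smooth_on_ext sf => // x Ax; congr (_ * _).
  by apply: eq_bigr => a _; apply: eq_bigr => b _; rewrite volume_formE.
apply: smooth_onM => //; first exact: smooth_on_cst.
apply: smooth_on_sum => // a _; apply: smooth_on_sum => // b _.
have sprod : smooth_on (coord i @` (U `&` dom i)) (fun x =>
    \prod_(l < n - size vs) invmx (g i (coordV i x)) (tnth a l) (tnth b l) : R^o).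
  apply: smooth_on_prod => // l _; apply: smooth_on_invmx => // x Ax.
  by rewrite unitmxE unitfE gt_eqF// det0.
have svol : smooth_on (coord i @` (U `&` dom i)) (fun x =>
    o i (coordV i x) * Num.sqrt (\det (g i (coordV i x))) : R^o).
  apply: (smooth_onM oA (orientation_smooth (i := i))).
  by apply: smooth_on_sqrt => //; exact: smooth_on_det.
apply: (smooth_onM oA (smooth_onM oA sprod (som i _)) (smooth_onM oA svol _)).
exact: smooth_on_cst.
Qed.

Lemma codiff_ext (omega theta : field M) :
  eq_on U omega theta -> eq_on U (codiff g o omega) (codiff g o theta).
Proof.
move=> E.
have E' : eq_on U (ext_d (star g o (eta omega))) (ext_d (star g o (eta theta))).
  apply: ext_d_ext => i p Uip vs; rewrite /star; congr (hodge_star _ _ _ _).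
  by apply/funext => us; rewrite /eta E.
move=> i p Uip vs.
(* [hodge_star_inv] makes its choice from a whole multicovector, so equality of values must first
   become equality of functions. *)
have Ep : ext_d (star g o (eta omega)) i p = ext_d (star g o (eta theta)) i p.
  by apply/funext => us; exact: E'.
exact: (congr1 (fun w => hodge_star_inv (g i p) (o i p) w vs) Ep).
Qed.

(** Between the two [d] stands [star eta star^-1], which multiplies by [(-1)^(n - m)] on lists of
    length [m]. This sign passes through the outer [d], leaving [d d], and [star^-1] sends zero to
    zero. *)
Lemma codiff_codiff (omega : field M) : smooth_field U omega ->
  eq_on U (codiff g o (codiff g o omega)) field0.
Proof.
move=> som.
have sst : smooth_field U (star g o (eta omega)).
  by apply: star_smooth; exact: eta_smooth.
pose theta := ext_d (star g o (eta omega)).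
have ath : alternating_field U theta.
  by apply: ext_d_alternating => // i p _; exact: hodge_star_alternating.
have E : eq_on U (star g o (eta (star_inv g o theta)))
    (fun i p vs => (-1) ^+ (n - size vs) * theta i p vs).
  move=> i p Uip vs; rewrite /star /eta /star_inv.
  rewrite (hodge_star_scale_size _ _ _ (fun m => (-1) ^+ m)).
  have [_ ->//] := hodge_star_invK (metric_sym Uip) (metric_det_gt0 Uip)
    (orientation_sqr Uip) (ath i p Uip).
have E0 : eq_on U (ext_d (star g o (eta (star_inv g o theta)))) field0.
  move=> i p Uip vs; rewrite (ext_d_ext E)//.
  rewrite (ext_d_scale_size (fun m => (-1) ^+ (n - m)) (ext_d_smooth sst))//.
  by rewrite ext_d_ext_d// mulr0.
move=> i p Uip vs; rewrite /codiff /star_inv.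
have -> : ext_d (star g o (eta (star_inv g o theta))) i p = fun=> 0.
  by apply/funext => us; exact: E0.
rewrite hodge_star_inv0//; [exact: metric_sym|exact: metric_det_gt0|].
exact: orientation_sqr.
Qed.

End Charts.

Theorem theorem4 (R : realType) (n : nat) (M : smooth_manifold R n)
    (U : set M) (U_star : star_shaped U)
    (g : chart M -> M -> 'M[R]_n) (g_metric : riemannian_metric U g)
    (o : chart M -> M -> R) (o_orientation : orientation U o)
    (k : nat) (k_gt0 : (0 < k)%N) (k_lt_n : (k < n)%N)
    (alpha beta : field M)
    (alpha_form : Lambda U k.-1 alpha) (beta_form : Lambda U k.+1 beta)
    (eq1 : eq_on U (codiff g o alpha) field0)
    (eq2 : eq_on U (sub_field (ext_d alpha) (codiff g o beta)) field0)
    (eq3 : eq_on U (ext_d beta) field0) :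
  ((closed_forms U k.-1 `&` coclosed_forms U g o k.-1) alpha /\
   (closed_forms U k.+1 `&` coclosed_forms U g o k.+1) beta)
  \/
  [/\ ~ closed_forms U k.-1 alpha,
      ~ coclosed_forms U g o k.+1 beta,
      (closed_forms U k `&` coclosed_forms U g o k) (ext_d alpha)
    & (closed_forms U k `&` coclosed_forms U g o k) (codiff g o beta)].
Proof.
have oU : open U by case: U_star.
have da_db : eq_on U (ext_d alpha) (codiff g o beta).
  by move=> i p Uip vs; apply/eqP; rewrite -subr_eq0; apply/eqP; exact: eq2.
have db_da : eq_on U (codiff g o beta) (ext_d alpha).
  by move=> i p Uip vs; rewrite da_db.
have [da0|da0] := pselect (eq_on U (ext_d alpha) field0).
  have db0 : eq_on U (codiff g o beta) field0.
    by move=> i p Uip vs; exact: etrans (db_da i p Uip vs) (da0 i p Uip vs).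
  by left; split; split; split; assumption.
right.
have da_form : Lambda U k (ext_d alpha).
  by rewrite -(prednK k_gt0); exact: ext_d_Lambda.
have dda : eq_on U (ext_d (ext_d alpha)) field0.
  exact: ext_d_ext_d oU _ (Lambda_smooth alpha_form).
have ddb : eq_on U (codiff g o (codiff g o beta)) field0.
  exact: (codiff_codiff oU g_metric o_orientation (Lambda_smooth beta_form)).
(* Smoothness and the transformation rule of [delta beta] are inherited from [d alpha], with which
   it agrees on [U]. *)
have db_form : Lambda U k (codiff g o beta) by exact: (Lambda_ext oU da_db da_form).
split.
- by case.
- case=> _ db0; apply: da0 => i p Uip vs.
  exact: etrans (da_db i p Uip vs) (db0 i p Uip vs).
- split; split; [exact: da_form|exact: dda|exact: da_form|] => i p Uip vs.
  exact: etrans (codiff_ext oU g o da_db Uip vs) (ddb i p Uip vs).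
- split; split; [exact: db_form| |exact: db_form|exact: ddb] => i p Uip vs.
  exact: etrans (ext_d_ext oU db_da Uip vs) (dda i p Uip vs).
Qed.
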